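(* Consider the balanced distributed multicategory setting described in the context. Suppose that the class-conditional distributions satisfy the sub-Gaussian condition with some parameter $\sigma^2>0$, that $\sup_j \boldsymbol\Sigma_{jj}\le c_0$ for some constant $c_0$, and that, with $\mathcal S=\{(j,k):\mathbf W^*_{jk}\ne 0\}$ the support of $\mathbf W^*$ and $s=|\mathcal S|$ its cardinality, $\boldsymbol\Sigma$ satisfies the RE$(\kappa_0,s)$ condition for some constant $\kappa_0>0$. Then there exist some universal constants $c_1,c_2,c_3$ such that the following holds. Put $$a_n=c_1\sqrt{\frac{\log(dM/\delta)}{N}}\,\|\mathbf W^*\|_{1,1}+c_2\sqrt{\frac{K\log(dMK/\delta)}{N}},\qquad b_n=2c_1\sqrt{\frac{\log(dM/\delta)}{n}},$$ $$\mathfrak a=\frac{192a_ns}{\kappa_0},\qquad \mathfrak b=\frac{192b_ns}{\kappa_0},$$ and let $(\hat{\mathbf W}_t)_{t\ge0}$ be the dmSLDA iterates defined in the context, with regularization parameters $\lambda_{t+1}=2a_n+2b_n\|\hat{\mathbf W}_t-\mathbf W^*\|_{1,1}$. Then for $n\ge c_3 s\log(d/\delta)$, the estimation error bounds $$\|\hat{\mathbf W}_{t+1}-\mathbf W^*\|_{1,1}\le\frac{\mathfrak a(1-\mathfrak b^{t+1})}{1-\mathfrak b}+\mathfrak b^{t+1}\|\hat{\mathbf W}_0-\mathbf W^*\|_{1,1},$$ $$\|\hat{\mathbf W}_{t+1}-\mathbf W^*\|_{2,2}\le\frac{\mathfrak a(1-\mathfrak b^{t+1})}{4\sqrt s(1-\mathfrak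 b)}+\frac{\mathfrak b^{t+1}}{4\sqrt s}\|\hat{\mathbf W}_0-\mathbf W^*\|_{1,1}$$ hold for all $t\ge0$ with probability at least $1-3\delta$. (Here $s\ge1$ and $\mathfrak b\ne1$, so that the expressions are defined.)
   Context: Norms: for a matrix $\mathbf A$ with rows $\mathbf A_{i\cdot}$, $\|\mathbf A\|_{p,q}$ is the $\ell_q$ norm of the vector $(\|\mathbf A_{i\cdot}\|_p)_i$; so $\|\cdot\|_{1,1}$ is the sum of absolute entries and $\|\cdot\|_{2,2}$ the Frobenius norm. $\langle\mathbf A,\mathbf B\rangle=\mathrm{Tr}(\mathbf A^\top\mathbf B)$. Here $\delta\in(0,1)$. Balanced setting: $K\ge2$ classes with equal prior probabilities $\pi_k=1/K$, dimension $d$, $M$ machines. On each machine $m\in\{1,\dots,M\}$ there are $n=Kb$ independent samples $(\mathbf x_i^m,y_i^m)$, $1\le i\le n$, $\mathbf x_i^m\in\mathbb R^d$, $y_i^m\in\{1,\dots,K\}$, with exactly $b\ge2$ samples of each class; samples on different machines are independent; $N=Mn$ is the full sample size. Given $y_i^m=k$, $\mathbf x_i^m$ has mean $\boldsymbol\mu_k\in\mathbb R^d$ and covariance $\boldsymbol\Sigma$ (the same nonsingular matrix for all classes). Sub-Gaussian condition with parameter $\sigma^2$: given $y=k$, $\mathbf z^k=\boldsymbol\Sigma^{-1/2}(\mathbf x-\boldsymbol\mu_k)$ (mean $\mathbf 0$, covariance $\mathbf I_d$) satisfies $\mathbb E[e^{\lambda\langle \mathbf v,\mathbf z^k\rangle}\mid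 y=k]\le e^{\lambda^2\sigma^2/2}$ for all $\lambda\in\mathbb R$ and all $\mathbf v\in\mathbb R^d$ with $\|\mathbf v\|_2=1$. RE$(\kappa_0,s)$ condition: for $\mathcal A\subset\{1,\dots,d\}$ let $\mathcal C(\mathcal A,3)=\{\boldsymbol\zeta\in\mathbb R^d:\|\boldsymbol\zeta_{\mathcal A^c}\|_1\le3\|\boldsymbol\zeta_{\mathcal A}\|_1\}$, where $\boldsymbol\zeta_{\mathcal A}$ keeps the coordinates in $\mathcal A$ and sets the others to $0$. The condition is $\boldsymbol\zeta^\top\boldsymbol\Sigma\boldsymbol\zeta\ge\kappa_0\|\boldsymbol\zeta\|_2^2$ for all $\boldsymbol\zeta\in\mathcal C(\mathcal A,3)$ and all $\mathcal A$ with $|\mathcal A|\le s$. Target: $\bar{\boldsymbol\mu}=\sum_k\pi_k\boldsymbol\mu_k$, $\mathbf U=(\boldsymbol\mu_1-\bar{\boldsymbol\mu},\dots,\boldsymbol\mu_{K-1}-\bar{\boldsymbol\mu})\in\mathbb R^{d\times(K-1)}$, and $\mathbf W^*=\arg\min_{\mathbf W\in\mathbb R^{d\times(K-1)}}\{\tfrac12\langle\mathbf W,\boldsymbol\Sigma\mathbf W\rangle-\langle\mathbf W,\mathbf U\rangle\}=\boldsymbol\Sigma^{-1}\mathbf U$. Local statistics on machine $m$: $\hat{\boldsymbol\mu}_k^m=\frac1b\sum_{i:y_i^m=k}\mathbf x_i^m$, $\hat{\bar{\boldsymbol\mu}}^m=\frac1n\sum_i\mathbf x_i^m$, $\hat{\boldsymbol\Sigma}^m=\frac1{n-K}\sum_{k=1}^K\sum_{i:y_i^m=k}(\mathbf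 x_i^m-\hat{\boldsymbol\mu}_k^m)(\mathbf x_i^m-\hat{\boldsymbol\mu}_k^m)^\top$, $\hat{\mathbf U}^m=(\hat{\boldsymbol\mu}_1^m-\hat{\bar{\boldsymbol\mu}}^m,\dots,\hat{\boldsymbol\mu}_{K-1}^m-\hat{\bar{\boldsymbol\mu}}^m)$. Local loss: $\mathcal L_m(\mathbf W)=\frac12\langle\mathbf W,\hat{\boldsymbol\Sigma}^m\mathbf W\rangle-\langle\mathbf W,\hat{\mathbf U}^m\rangle$. dmSLDA (distributed multicategory sparse linear discriminant analysis) iterates: $\hat{\mathbf W}_0\in\arg\min_{\mathbf W\in\mathbb R^{d\times(K-1)}}\{\mathcal L_1(\mathbf W)+\lambda_0\|\mathbf W\|_{1,1}\}$ with $\lambda_0>0$, and for $t\ge1$, $\hat{\mathbf W}_t\in\arg\min_{\mathbf W\in\mathbb R^{d\times(K-1)}}\{\mathcal L_1(\mathbf W)+\langle\frac1M\sum_{m=1}^M\nabla\mathcal L_m(\hat{\mathbf W}_{t-1})-\nabla\mathcal L_1(\hat{\mathbf W}_{t-1}),\mathbf W\rangle+\lambda_t\|\mathbf W\|_{1,1}\}$. *)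

(* Defs.v *)
From HB Require Import structures.
From mathcomp Require Export all_boot all_order all_algebra.
From mathcomp Require Export all_classical all_reals all_analysis.

Set Implicit Arguments.
Unset Strict Implicit.
Unset Printing Implicit Defensive.

Import Order.TTheory GRing.Theory Num.Theory.
Import numFieldNormedType.Exports.

Local Open Scope classical_set_scope.
Local Open Scope ring_scope.

Section Norms.
Variable R : realType.

(* Meant for 1 <= p: the `l_p` norm of the vector x. *)
Definition vnorm (p : R) n (x : 'I_n -> R) : R :=
  (\sum_i `|x i| `^ p) `^ p^-1.

(* The `l_q` norm of the vector of the `l_p` norms of the rows of A. *)
Definition mxnorm (p q : R) m n (A : 'M[R]_(m, n)) : R :=
  vnorm q (fun i => vnorm p (fun j => A i j)).

Definition mxdot m n (A B : 'M[R]_(m, n)) : R := \tr (A^T *m B).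

Lemma vnorm1E n (x : 'I_n -> R) : vnorm 1 x = \sum_i `|x i|.
Proof.
rewrite /vnorm invr1 powRr1; last by apply: sumr_ge0 => i _; exact: powR_ge0.
by apply: eq_bigr => i _; rewrite powRr1.
Qed.

Lemma vnorm2E n (x : 'I_n -> R) : vnorm 2 x = Num.sqrt (\sum_i x i ^+ 2).
Proof.
rewrite /vnorm powR12_sqrt; last by apply: sumr_ge0 => i _; exact: powR_ge0.
by congr Num.sqrt; apply: eq_bigr => i _; rewrite powR_mulrn// real_normK ?num_real.
Qed.

Lemma mxnorm11E m n (A : 'M[R]_(m, n)) :
  mxnorm 1 1 A = \sum_i \sum_j `|A i j|.
Proof. by rewrite /mxnorm vnorm1E; apply: eq_bigr => i _;
  rewrite vnorm1E ger0_norm// sumr_ge0. Qed.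

Lemma mxnorm22E m n (A : 'M[R]_(m, n)) :
  mxnorm 2 2 A = Num.sqrt (\sum_i \sum_j A i j ^+ 2).
Proof.
rewrite /mxnorm vnorm2E; congr Num.sqrt; apply: eq_bigr => i _.
by rewrite vnorm2E sqr_sqrtr// sumr_ge0// => j _; exact: sqr_ge0.
Qed.

End Norms.

Section Optimization.
Variable R : realType.

Definition is_argmin (T : Type) (f : T -> R) (x : T) : Prop :=
  forall y, f x <= f y.

Definition gradient m n (f : 'M[R]_(m, n) -> R) (W : 'M[R]_(m, n)) :
    'M[R]_(m, n) :=
  \matrix_(j, k) 'D_(delta_mx j k) f W.

End Optimization.

Section Population.
Variable R : realType.

Definition posdefmx d (A : 'M[R]_d) : Prop :=
  A^T = A /\ forall v : 'cV[R]_d, v != 0 -> 0 < (v^T *m A *m v) 0 0.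

(* For S symmetric positive definite there is exactly one such A, namely
   S^{-1/2}. *)
Definition is_inv_sqrtmx d (S A : 'M[R]_d) : Prop :=
  posdefmx A /\ A *m A = invmx S.

(* Random vectors take their values in d.-tuple R, which carries the product
   sigma-algebra; col_of_tuple is the same point as a column vector. *)
Definition col_of_tuple d (x : d.-tuple R) : 'cV[R]_d :=
  \col_j tnth x j.

(* Square integrability of the coordinates is what makes the mean and the
   covariance meaningful: the integral is a total function. *)
Definition has_mean_cov d (Q : probability (d.-tuple R) R)
    (mu : 'cV[R]_d) (S : 'M[R]_d) : Prop :=
  [/\ forall j, (fun x : d.-tuple R => tnth x j) \in Lfun Q 2%:E,
      forall j, ('E_Q[fun x : d.-tuple R => tnth x j] = (mu j 0)%:E)%E &
      forall j l, covariance Q (fun x : d.-tuple R => tnth x j)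
                               (fun x : d.-tuple R => tnth x l)
                  = (S j l)%:E].

Definition sub_gaussian d (sigma2 : R) (Q : probability (d.-tuple R) R)
    (mu : 'cV[R]_d) (S : 'M[R]_d) : Prop :=
  exists2 A : 'M[R]_d, is_inv_sqrtmx S A &
    forall (lam : R) (v : 'cV[R]_d), vnorm 2 (fun j => v j 0) = 1 ->
      ('E_Q[fun x : d.-tuple R =>
              expR (lam * mxdot v (A *m (col_of_tuple x - mu)))]
       <= (expR (lam ^+ 2 * sigma2 / 2))%:E)%E.

Definition in_cone d (A : {set 'I_d}) (zeta : 'cV[R]_d) : Prop :=
  vnorm 1 (fun j => if j \in A then 0 else zeta j 0)
  <= 3 * vnorm 1 (fun j => if j \in A then zeta j 0 else 0).

Definition restricted_eigenvalue d (kappa0 : R) (s : nat) (S : 'M[R]_d) : Prop :=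
  forall (A : {set 'I_d}) (zeta : 'cV[R]_d),
    (#|A| <= s)%N -> in_cone A zeta ->
    kappa0 * vnorm 2 (fun j => zeta j 0) ^+ 2 <= (zeta^T *m S *m zeta) 0 0.

Definition mxsupp m n (W : 'M[R]_(m, n)) : {set 'I_m * 'I_n} :=
  [set jk | W jk.1 jk.2 != 0]%SET.

(* Only the first K - 1 classes contribute a column. *)
Definition centered_means d K (mu : 'I_K -> 'cV[R]_d) (mbar : 'cV[R]_d) :
    'M[R]_(d, K.-1) :=
  \matrix_(j, k) (mu (widen_ord (leq_pred K) k) - mbar) j 0.

Definition population_U d K (mu : 'I_K -> 'cV[R]_d) : 'M[R]_(d, K.-1) :=
  centered_means mu (\sum_k K%:R^-1 *: mu k).

Definition lda_loss d p (S : 'M[R]_d) (U W : 'M[R]_(d, p)) : R :=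
  2^-1 * mxdot W (S *m W) - mxdot W U.

End Population.

Section Sampling.
Variable R : realType.

(* The product rule over every subfamily. *)
Definition mutually_independent dT (T : measurableType dT)
    (P : probability T R) dT' (T' : measurableType dT') (I : finType)
    (X : I -> {RV P >-> T'}) : Prop :=
  forall (J : {set I}) (B : I -> set T'),
    (forall i, i \in J -> measurable (B i)) ->
    (P [set w | forall i, i \in J -> B i (X i w)]
     = \prod_(i in J) P (X i @^-1` B i))%E.

Definition has_law dT (T : measurableType dT) (P : probability T R)
    dT' (T' : measurableType dT') (X : {RV P >-> T'})
    (Q : probability T' R) : Prop :=
  forall B : set T', measurable B -> distribution P X B = Q B.

Definition balanced_labels K b (y : 'I_(K * b) -> 'I_K) : Prop :=
  forall k, #|[set i | y i == k]%SET| = b.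

End Sampling.

Section Local_statistics.
Variables (R : realType) (d K b : nat).
Variables (y : 'I_(K * b) -> 'I_K) (x : 'I_(K * b) -> 'cV[R]_d).

Definition class_mean (k : 'I_K) : 'cV[R]_d :=
  b%:R^-1 *: \sum_(i | y i == k) x i.

Definition grand_mean : 'cV[R]_d := (K * b)%:R^-1 *: \sum_i x i.

Definition pooled_cov : 'M[R]_d :=
  ((K * b)%:R - K%:R)^-1 *:
    \sum_k \sum_(i | y i == k)
      (x i - class_mean k) *m (x i - class_mean k)^T.

Definition local_U : 'M[R]_(d, K.-1) := centered_means class_mean grand_mean.

Definition local_loss : 'M[R]_(d, K.-1) -> R := lda_loss pooled_cov local_U.

End Local_statistics.

Section Algorithm.
Variable R : realType.

(* m1 is the machine that solves the penalized problems; lambda 0 is used for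
   the initial estimator. *)
Definition dmSLDA_iterates d p M (m1 : 'I_M) (L : 'I_M -> 'M[R]_(d, p) -> R)
    (lambda : nat -> R) (What : nat -> 'M[R]_(d, p)) : Prop :=
  is_argmin (fun W => L m1 W + lambda 0%N * mxnorm 1 1 W) (What 0%N) /\
  forall t : nat,
    is_argmin
      (fun W =>
         L m1 W
         + mxdot (M%:R^-1 *: (\sum_m gradient (L m) (What t))
                  - gradient (L m1) (What t)) W
         + lambda t.+1 * mxnorm 1 1 W)
      (What t.+1).

End Algorithm.

(* Main.v *)
(** Every penalized problem separates over the columns of [W], so the basic
    lasso inequality holds column by column: the error of each column lies in
    the cone of the support of that column of [W*], and a restricted eigenvalue
    condition for vectors suffices even though the unknown is a matrix. Combined
    with the bound [lambda / 2] on the entries of the gradient of the surrogate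
    loss at [W*], this gives an affine recursion for the l1 error, and the
    Frobenius bound follows from one more step.

    The entrywise deviations of the pooled covariances are sums of squares of
    sub-Gaussian variables: the within-class scatter in a direction [u] is the
    sum of the squared noises minus, for every machine and class, the squared
    normalized class sum, and both are controlled by Chernoff's bound.

    The restricted eigenvalue of the sample covariance of the first machine is
    needed already when [n] is of order [s log(d / delta)], where entrywise
    deviations are too weak. By Maurey's empirical method, a quadratic form that
    is nonnegative on all sums of [k + 1] signed unit vectors is at least
    [- D |zeta|_1^2 / k] at [zeta], where [D] bounds its diagonal. There are
    only [(2d)^(k+1)] such sums, so a union bound with [k] proportional to [s]
    is enough. *)

From HB Require Import structures.
Require Import Defs.
From mathcomp Require Import all_boot all_order all_algebra.
From mathcomp Require Import all_classical all_reals all_analysis.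
From mathcomp Require Import measurable_realfun.
From mathcomp Require Import ring lra.

Set Implicit Arguments.
Unset Strict Implicit.
Unset Printing Implicit Defensive.

Import Order.TTheory GRing.Theory Num.Theory.
Import numFieldNormedType.Exports.

Local Open Scope classical_set_scope.
Local Open Scope ring_scope.

(** * Independence *)

(** The sub-Gaussian condition concerns the whitened variable, so the noise in a direction [u] has
    variance proxy [sigma2 * bform Sigma u u], proportional to its variance. Deviations of quadratic
    forms are therefore relative to the population form. This permits the comparison of the sample
    covariance with half of [Sigma] on walks, and keeps the largest eigenvalue of [Sigma] out of the
    constants, which see [Sigma] only through its diagonal and [kappa0]. A squared sub-Gaussian
    variable has exponential moments only near zero, so the Chernoff exponent is quadratic in the
    relative deviation [t] only for [t <= 1]; the sample size must dominate the logarithms for that.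
    The hypothesis makes [n] dominate [ln (d / delta)], but not [ln M]: the level [ln (d M / delta)]
    is used only for covariances averaged over all machines, where [N = M n] absorbs [ln M]. Class
    sums and samples are dependent, so the two parts of a scatter are bounded separately and joined
    by a union bound. *)

Section Sigma_independence.
Context d (T : measurableType d) (R : realType) (P : probability T R).
Implicit Types G H : set (set T).

(** For a fixed [B] both sides are finite measures in [A]; they agree on a pi-system that contains
    the whole space, hence on the sigma-algebra it generates. *)
Lemma g_sigma_indep_l G B : setI_closed G -> G setT -> G `<=` measurable ->
  measurable B -> (forall A, G A -> P (A `&` B) = P A * P B)%E ->
  forall A, <<s G >> A -> (P (A `&` B) = P A * P B)%E.
Proof.
move=> GI GT Gm mB GB.
have PBfin : P B \is a fin_num by exact: fin_num_measure.
have PB0 : 0 <= fine (P B) by exact: fine_ge0.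
pose m1 : {measure set T -> \bar R} := mrestr P mB.
pose m2 : {measure set T -> \bar R} := mscale (NngNum PB0) P.
move=> A sA.
have : m1 A = m2 A.
  apply: (@g_sigma_algebra_measure_unique _ _ _ G Gm (fun=> setT)) => //.
  - by rewrite bigcup_const //; exists 0%N.
  - move=> C GC; rewrite /m1 /m2 /= /mrestr /mscale/= GB// muleC.
    by congr (_ * _)%E; rewrite /= fineK.
  - move=> _; rewrite /m1 /= /mrestr setTI.
    by rewrite (le_lt_trans (probability_le1 _ mB))// ltry.
by rewrite /m1 /m2 /= /mrestr /mscale/= => ->; rewrite fineK// muleC.
Qed.

Lemma g_sigma_indep G H : setI_closed G -> G setT -> G `<=` measurable ->
  setI_closed H -> H setT -> H `<=` measurable ->
  (forall A B, G A -> H B -> P (A `&` B) = P A * P B)%E ->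
  forall A B, <<s G >> A -> <<s H >> B -> (P (A `&` B) = P A * P B)%E.
Proof.
move=> GI GT Gm HI HT Hm GH A B sA sB.
have sGm : <<s G >> `<=` measurable.
  by apply: smallest_sub => //; exact: sigma_algebra_measurable.
rewrite setIC muleC; apply: (g_sigma_indep_l HI HT Hm (sGm _ sA)) => // C HC.
rewrite setIC muleC; apply: (g_sigma_indep_l GI GT Gm (Hm _ HC)) => // D GD.
exact: GH.
Qed.

End Sigma_independence.

Section Independent_functions.
Context d (T : measurableType d) (R : realType) (P : probability T R).
Variables (f g : T -> R).
Hypotheses (mf : measurable_fun setT f) (mg : measurable_fun setT g).
Hypothesis fg : forall A B, measurable A -> measurable B ->
  (P (f @^-1` A `&` g @^-1` B) = P (f @^-1` A) * P (g @^-1` B))%E.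

(** The joint law of [f] and [g] is a product measure, since such a measure is determined by
    rectangles; Tonelli's theorem then factors the integral without any integrability. *)
Lemma ge0_expectation_indep : (forall x, 0 <= f x) -> (forall x, 0 <= g x) ->
  ('E_P[f \* g] = 'E_P[f] * 'E_P[g])%E.
Proof.
move=> f0 g0; rewrite unlock.
pose h x : R * R := (f x, g x).
have mh : measurable_fun setT h by exact: measurable_fun_pair.
pose fm : {mfun T >-> R} := HB.pack f (isMeasurableFun.Build _ _ _ _ _ mf).
pose gm : {mfun T >-> R} := HB.pack g (isMeasurableFun.Build _ _ _ _ _ mg).
pose hm : {mfun T >-> (R * R)%type} :=
  HB.pack h (isMeasurableFun.Build _ _ _ _ _ mh).
(* The absolute values make the integrand nonnegative on the whole plane; at values of [f] and [g]
   they have no effect. *)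
pose k : R * R -> R := fun z => `|z.1| * `|z.2|.
have mk : measurable_fun setT k.
  apply: measurable_funM.
    by apply: measurableT_comp => //.
  by apply: measurableT_comp => //.
have k0 z : (0 <= (k z)%:E)%E by rewrite lee_fin mulr_ge0.
have mk' : measurable_fun setT (EFin \o k) by exact/measurable_EFinP.
transitivity (\int[distribution P hm]_z (EFin \o k) z)%E.
  rewrite ge0_integral_distribution//; apply: eq_integral => x _ /=.
  by rewrite /k /= !ger0_norm.
transitivity (\int[distribution P fm \x distribution P gm]_z (EFin \o k) z)%E.
  apply: eq_measure_integral => A mA _; apply/esym.
  by apply: product_measure_unique => // B C mB mC; rewrite -fg.
rewrite fubini_tonelli1//.
transitivity (\int[distribution P fm]_x
    (`|x|%:E * \int[distribution P gm]_y `|y|%:E))%E.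
  apply: eq_integral => x _; rewrite /fubini_F /k /=.
  under eq_integral do rewrite EFinM.
  by rewrite ge0_integralZl//; exact/measurable_EFinP.
have mn : measurable_fun setT (fun x : R => `|x|%:E) by exact/measurable_EFinP.
rewrite ge0_integralZr ?integral_ge0//; congr (_ * _)%E.
  rewrite ge0_integral_distribution//; apply: eq_integral => x _ /=.
  by rewrite ger0_norm.
rewrite ge0_integral_distribution//; apply: eq_integral => x _ /=.
by rewrite ger0_norm.
Qed.

End Independent_functions.

Section Signed_independence.
Context d (T : measurableType d) (R : realType) (P : probability T R).

Lemma ge0_Lfun1_mul_indep (f g : T -> R) :
  measurable_fun setT f -> measurable_fun setT g ->
  (forall A B, measurable A -> measurable B ->
    (P (f @^-1` A `&` g @^-1` B) = P (f @^-1` A) * P (g @^-1` B))%E) ->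
  (forall x, 0 <= f x) -> (forall x, 0 <= g x) ->
  f \in Lfun P 1 -> g \in Lfun P 1 -> f \* g \in Lfun P 1.
Proof.
move=> mf mg fg f0 g0 f1 g1; apply/Lfun1_integrable/integrableP; split.
  by apply/measurable_EFinP; exact: measurable_funM.
have -> : (\int[P]_x `|(f \* g)%R x|%:E = 'E_P[f \* g])%E.
  rewrite unlock; apply: eq_integral => x _ /=.
  by rewrite ger0_norm// mulr_ge0.
rewrite ge0_expectation_indep//.
by rewrite -(fineK (expectation_fin_num f1)) -(fineK (expectation_fin_num g1))
  -EFinM ltry.
Qed.

(** Positive and negative parts are functions of [f] and of [g], so the nonnegative case applies to
    the four products. It also gives their integrability, which justifies expanding the
    expectation. *)
Lemma expectation_indep (f g : T -> R) :
  measurable_fun setT f -> measurable_fun setT g ->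
  (forall A B, measurable A -> measurable B ->
    (P (f @^-1` A `&` g @^-1` B) = P (f @^-1` A) * P (g @^-1` B))%E) ->
  f \in Lfun P 1 -> g \in Lfun P 1 ->
  ('E_P[f \* g] = 'E_P[f] * 'E_P[g])%E.
Proof.
move=> mf mg fg f1 g1.
pose pos (x : R) := Num.max x 0; pose neg (x : R) := Num.max (- x) 0.
have mpos : measurable_fun setT pos by exact: measurable_maxr.
have mneg : measurable_fun setT neg.
  by apply: measurable_maxr => //; exact: measurable_funN.
have pos0 x : 0 <= pos x by rewrite le_max lexx orbT.
have neg0 x : 0 <= neg x by rewrite le_max lexx orbT.
have posneg x : x = pos x - neg x by rewrite /pos /neg; case: (ler0P x); case: (ler0P (- x)); lra.
have ind (p q : R -> R) : measurable_fun setT p -> measurable_fun setT q ->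
    forall A B, measurable A -> measurable B ->
    (P ((p \o f) @^-1` A `&` (q \o g) @^-1` B) =
     P ((p \o f) @^-1` A) * P ((q \o g) @^-1` B))%E.
  move=> mp mq A B mA mB; apply: (fg (p @^-1` A) (q @^-1` B)).
    by rewrite -[X in measurable X]setTI; exact: mp.
  by rewrite -[X in measurable X]setTI; exact: mq.
have L1 (h : T -> R) (p : R -> R) : measurable_fun setT h -> measurable_fun setT p ->
    (forall x, `|p x| <= `|x|) -> h \in Lfun P 1 -> p \o h \in Lfun P 1.
  move=> mh mp ph /Lfun1_integrable h1; apply/Lfun1_integrable.
  apply: le_integrable h1 => //.
    by apply/measurable_EFinP; exact: measurableT_comp.
  by move=> x _ /=; rewrite lee_fin.
have pos_le x : `|pos x| <= `|x|.
  by rewrite ger0_norm// /pos ge_max normr_ge0 ler_norm.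
have neg_le x : `|neg x| <= `|x|.
  by rewrite ger0_norm// /neg ge_max normr_ge0 -normrN ler_norm.
have fp1 := L1 _ _ mf mpos pos_le f1; have fn1 := L1 _ _ mf mneg neg_le f1.
have gp1 := L1 _ _ mg mpos pos_le g1; have gn1 := L1 _ _ mg mneg neg_le g1.
have mfp := measurableT_comp mpos mf; have mfn := measurableT_comp mneg mf.
have mgp := measurableT_comp mpos mg; have mgn := measurableT_comp mneg mg.
have e1 := ge0_expectation_indep mfp mgp (ind _ _ mpos mpos) (fun x => pos0 _) (fun x => pos0 _).
have e2 := ge0_expectation_indep mfp mgn (ind _ _ mpos mneg) (fun x => pos0 _) (fun x => neg0 _).
have e3 := ge0_expectation_indep mfn mgp (ind _ _ mneg mpos) (fun x => neg0 _) (fun x => pos0 _).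
have e4 := ge0_expectation_indep mfn mgn (ind _ _ mneg mneg) (fun x => neg0 _) (fun x => neg0 _).
have i1 := ge0_Lfun1_mul_indep mfp mgp (ind _ _ mpos mpos) (fun x => pos0 _) (fun x => pos0 _) fp1 gp1.
have i2 := ge0_Lfun1_mul_indep mfp mgn (ind _ _ mpos mneg) (fun x => pos0 _) (fun x => neg0 _) fp1 gn1.
have i3 := ge0_Lfun1_mul_indep mfn mgp (ind _ _ mneg mpos) (fun x => neg0 _) (fun x => pos0 _) fn1 gp1.
have i4 := ge0_Lfun1_mul_indep mfn mgn (ind _ _ mneg mneg) (fun x => neg0 _) (fun x => neg0 _) fn1 gn1.
have -> : f \* g = ((pos \o f) \* (pos \o g) \- (pos \o f) \* (neg \o g))
    \- ((neg \o f) \* (pos \o g) \- (neg \o f) \* (neg \o g)).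
  apply/funext => x /=; rewrite {1}(posneg (f x)) {1}(posneg (g x)); ring.
have -> : ('E_P[f] = 'E_P[(pos \o f) \- (neg \o f)])%E.
  by congr expectation; apply/funext => x /=; exact: posneg.
have -> : ('E_P[g] = 'E_P[(pos \o g) \- (neg \o g)])%E.
  by congr expectation; apply/funext => x /=; exact: posneg.
rewrite !expectationB ?rpredB// e1 e2 e3 e4.
rewrite -(fineK (expectation_fin_num fp1)) -(fineK (expectation_fin_num fn1)).
rewrite -(fineK (expectation_fin_num gp1)) -(fineK (expectation_fin_num gn1)).
by rewrite -!(EFinM, EFinB); congr EFin; ring.
Qed.

End Signed_independence.

Section Blocks.
Context d (T : measurableType d) (R : realType) (P : probability T R).
Context d' (T' : measurableType d') (I : finType) (X : I -> {RV P >-> T'}).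
Hypothesis indepX : mutually_independent X.
Implicit Types J : {set I}.

(** A pi-system generating the sigma-algebra of the variables with index in [J], on which
    independence is just the product rule. *)
Definition cylinders J : set (set T) :=
  [set A | exists2 B : I -> set T', (forall i, i \in J -> measurable (B i)) &
     A = [set w | forall i, i \in J -> B i (X i w)]].

Definition adapted J (f : T -> R) : Prop :=
  measurable_fun [set: g_sigma_algebraType (cylinders J)] f.

Lemma cylinders_setI J : setI_closed (cylinders J).
Proof.
move=> _ _ [B mB ->] [C mC ->]; exists (fun i => B i `&` C i).
  by move=> i iJ; apply: measurableI; [exact: mB|exact: mC].
apply/seteqP; split => [w [/= Bw Cw] i iJ|w /= BCw].
  by split; [exact: Bw|exact: Cw].
by split => i /BCw[].
Qed.

Lemma cylinders_setT J : cylinders J setT.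
Proof. by exists (fun=> setT) => //; apply/seteqP; split. Qed.

Lemma cylinders_measurable J : cylinders J `<=` measurable.
Proof.
move=> _ [B mB ->].
rewrite (_ : [set w | _] = \bigcap_(i in [set` J]) (X i @^-1` B i))//.
apply: fin_bigcap_measurable => // i iJ; rewrite -[X in measurable X]setTI.
by apply: measurable_funP => //; exact: mB.
Qed.

Lemma cylinders_sub J J' : J \subset J' -> cylinders J `<=` cylinders J'.
Proof.
move=> /fintype.subsetP JJ' _ [B mB ->].
exists (fun i => if i \in J then B i else setT).
  by move=> i _; case: ifPn => // /mB.
apply/seteqP; split => [w Bw i _ /=|w Bw i iJ /=].
  by case: ifPn => // /Bw.
by move: (Bw i (JJ' _ iJ)); rewrite iJ.
Qed.

Lemma adapted_sub J J' f : J \subset J' -> adapted J f -> adapted J' f.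
Proof.
move=> JJ' mf _ B mB; have := mf measurableT B mB.
by apply: sub_smallest2r => //; exact: cylinders_sub.
Qed.

Lemma g_sigma_cylinders_measurable J : <<s cylinders J >> `<=` measurable.
Proof.
apply: smallest_sub; first exact: sigma_algebra_measurable.
exact: cylinders_measurable.
Qed.

Lemma adapted_measurable J f : adapted J f -> measurable_fun setT f.
Proof.
by move=> mf _ B mB; apply: g_sigma_cylinders_measurable; exact: mf.
Qed.

Lemma adapted_comp i J (h : T' -> R) : i \in J ->
  measurable_fun setT h -> adapted J (h \o X i).
Proof.
move=> iJ mh _ B mB; rewrite setTI; apply: sub_sigma_algebra.
exists (fun k => if k == i then h @^-1` B else setT).
  by move=> k _; case: eqP => // _; rewrite -[X in measurable X]setTI; exact: mh.
apply/seteqP; split => [w Bw k _ /=|w /(_ i iJ)]; last by rewrite eqxx.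
by case: eqP => // ->.
Qed.

(** On cylinders over disjoint blocks the product over [J :|: J'] splits; the pi-system argument
    carries this to the generated sigma-algebras. *)
Lemma adapted_indep J J' f g : [disjoint J & J']%B ->
  adapted J f -> adapted J' g -> forall A B, measurable A -> measurable B ->
  (P (f @^-1` A `&` g @^-1` B) = P (f @^-1` A) * P (g @^-1` B))%E.
Proof.
move=> JJ' mf mg A B mA mB.
have := mf measurableT A mA; have := mg measurableT B mB; rewrite !setTI => gB fA.
apply: (g_sigma_indep (@cylinders_setI J) (@cylinders_setT J)
  (@cylinders_measurable J) (@cylinders_setI J') (@cylinders_setT J')
  (@cylinders_measurable J')) => // _ _ [C mC ->] [D mD ->].
(* The two families glue into one over the union, as no index lies in both blocks. *)
pose E i := if i \in J then C i else D i.
have JJ'i i : i \in J' -> (i \in J) = false.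
  by move=> iJ'; apply: contraTF JJ' => iJ; apply/pred0Pn; exists i; rewrite /= iJ.
have -> : [set w | forall i, i \in J -> C i (X i w)] `&`
          [set w | forall i, i \in J' -> D i (X i w)] =
          [set w | forall i, i \in J :|: J' -> E i (X i w)].
  apply/seteqP; split => [w [/= Cw Dw] i|w /= Ew].
    by rewrite /E inE; case: ifPn => [/Cw //|_ /Dw].
  split => i iJ.
    by have := Ew i; rewrite /E inE iJ; exact.
  by have := Ew i; rewrite /E inE iJ orbT JJ'i//; exact.
rewrite !indepX//; last first.
  by move=> i; rewrite inE /E; case: ifPn => [/mC//|_ /mD].
rewrite (eq_bigl [predU J & J']) => [|i]; last by rewrite !inE.
rewrite bigU//=; congr (_ * _)%E; apply: eq_bigr => i iJ.
  by rewrite /E iJ.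
by rewrite /E JJ'i.
Qed.

Lemma adapted_prod J (G : eqType) (s : seq G) (f : G -> T -> R) :
  (forall g, g \in s -> adapted J (f g)) ->
  adapted J (fun x => \prod_(g <- s) f g x).
Proof.
elim: s => [_|g s IH fJ]; rewrite /adapted.
  by under eq_fun do rewrite big_nil; exact: measurable_cst.
under eq_fun do rewrite big_cons.
apply: measurable_funM; first exact: fJ (mem_head _ _).
by apply: IH => h hs; apply: fJ; rewrite inE hs orbT.
Qed.

Lemma adapted_sum J (G : eqType) (s : seq G) (f : G -> T -> R) :
  (forall g, g \in s -> adapted J (f g)) ->
  adapted J (fun x => \sum_(g <- s) f g x).
Proof.
elim: s => [_|g s IH fJ]; rewrite /adapted.
  by under eq_fun do rewrite big_nil; exact: measurable_cst.
under eq_fun do rewrite big_cons.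
apply: measurable_funD; first exact: fJ (mem_head _ _).
by apply: IH => h hs; apply: fJ; rewrite inE hs orbT.
Qed.

Lemma adapted_measurable_comp J (h : R -> R) f :
  measurable_fun setT h -> adapted J f -> adapted J (h \o f).
Proof. by move=> mh mf; exact: measurableT_comp. Qed.

(** The product of the remaining factors is adapted to the union of their blocks, which is disjoint
    from the first block. Nonnegativity allows infinite expectations. *)
Lemma ge0_expectation_prod_adapted (G : eqType) (J : G -> {set I})
    (f : G -> T -> R) (s : seq G) : uniq s ->
  (forall g h, g \in s -> h \in s -> g != h -> [disjoint J g & J h]%B) ->
  (forall g, g \in s -> adapted (J g) (f g)) ->
  (forall g x, g \in s -> 0 <= f g x) ->
  ('E_P[fun x => (\prod_(g <- s) f g x)%R] = \prod_(g <- s) 'E_P[f g])%E.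
Proof.
elim: s => [|g s IH] /=.
  move=> _ _ _ _; under eq_fun do rewrite big_nil.
  by rewrite big_nil expectation_cst.
move=> /andP[gs us] dJ fJ f0; rewrite big_cons.
have sub h : h \in s -> h \in g :: s by rewrite inE => ->; rewrite orbT.
rewrite -IH//; last 3 first.
- by move=> h k /sub hs /sub ks; exact: dJ.
- by move=> h /sub; exact: fJ.
- by move=> h x /sub; exact: f0.
under eq_fun do rewrite big_cons.
have fg := fJ g (mem_head _ _).
pose K := [set i | has (fun h => i \in J h) s]%SET.
have ff : adapted K (fun x => \prod_(h <- s) f h x).
  apply: adapted_prod => h hs; apply: adapted_sub (fJ h (sub _ hs)).
  by apply/fintype.subsetP => i iJ; rewrite inE; apply/hasP; exists h.
apply: ge0_expectation_indep.
- exact: adapted_measurable fg.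
- exact: adapted_measurable ff.
- apply: adapted_indep fg ff.
  apply/pred0Pn => -[i /andP[/= ig]]; rewrite inE => /hasP[h hs ih].
  have gh : g != h by apply: contraNneq gs => ->.
  have /pred0Pn := dJ g h (mem_head _ _) (sub _ hs) gh; apply.
  by exists i; rewrite /= ig.
- by move=> x; exact: f0 (mem_head _ _).
- move=> x; rewrite big_seq; apply: prodr_ge0 => h hs; apply: f0.
  exact: sub.
Qed.

End Blocks.

(** * Sub-Gaussian variables and their squares *)

Section Real_inequalities.
Context {R : realType}.
Implicit Types x : R.

Lemma exprn_fact_le_expR x n : 0 <= x -> x ^+ n / n`!%:R <= expR x.
Proof.
move=> x0; case: n => [|n].
  by rewrite expr0 fact0 divr1 -expR0 ler_expR.
by apply: le_trans (expR_ge1Dxn n x0); rewrite lerDr.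
Qed.

Lemma expR1_le4 : expR 1 <= 4 :> R.
Proof.
have h : (expR (2^-1) : R)^-1 >= 2^-1.
  by rewrite -expRN; apply: le_trans (expR_ge1Dx _); lra.
have e0 : 0 < expR (2^-1) :> R := expR_gt0 _.
have h2 : expR (2^-1) <= 2 :> R.
  by move: h; rewrite lef_pV2 ?posrE.
rewrite (_ : 1 = 2^-1 + 2^-1 :> R); last by lra.
rewrite expRD; nra.
Qed.

(** A Taylor bound on the whole line: the linear term vanishes for a centered variable, which leaves
    a remainder of second order in the parameter. For [x >= 0] it is [expR x - 1 <= x * expR x] used
    twice. *)
Lemma expR_le_quadratic x : expR x <= 1 + x + x ^+ 2 * expR `|x|.
Proof.
have [x0|x0] := leP 0 x.
  rewrite ger0_norm//.
  have h : expR x * (1 - x) <= 1.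
    rewrite -[leRHS](expRxMexpNx_1 x) ler_pM2l ?expR_gt0//.
    exact: expR_ge1Dx.
  have h1 : expR x - 1 <= x * expR x by nra.
  have : x * (expR x - 1) <= x * (x * expR x) by rewrite ler_wpM2l.
  nra.
rewrite ltr0_norm//; set y := - x; have y0 : 0 < y by rewrite /y oppr_gt0.
have -> : x = - y by rewrite /y opprK.
have h : (1 + y) * expR (- y) <= 1.
  by rewrite -[leRHS](expRxMexpNx_1 y) ler_pM2r ?expR_gt0// expR_ge1Dx.
have h1 : 1 <= expR y by rewrite -expR0 ler_expR ltW.
have h2 : 1 - y <= expR (- y) by exact: expR_ge1Dx.
have : y ^+ 2 <= y ^+ 2 * expR y by rewrite ler_peMr ?sqr_ge0.
have : 0 <= expR (- y) by exact: expR_ge0.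
rewrite sqrrN; nra.
Qed.

Lemma sqr_le_expR x : 0 <= x -> x ^+ 2 <= 4 * expR x.
Proof.
move=> x0; have := exprn_fact_le_expR 2 x0.
have : 0 <= expR x by exact: expR_ge0.
rewrite (_ : 2`!%:R = 2 :> R)//; lra.
Qed.

Lemma ffact_le_expn n m : (n ^_ m <= n ^ m)%N.
Proof.
elim: m => // m IH; rewrite ffactnSr expnSr.
by apply: leq_mul => //; exact: leq_subr.
Qed.

End Real_inequalities.

Section Nonnegative_expectation.
Context d (T : measurableType d) (R : realType) (P : probability T R).
Implicit Types f g : T -> R.

Lemma ge0_expectationZl (k : R) f : measurable_fun setT f ->
  (forall x, 0 <= f x) -> 0 <= k -> ('E_P[fun x => (k * f x)%R] = k%:E * 'E_P[f])%E.
Proof.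
move=> mf f0 k0; rewrite unlock; under eq_integral do rewrite EFinM.
rewrite ge0_integralZl//; first exact/measurable_EFinP.
by move=> x ?; exact: f0.
Qed.

Lemma ge0_expectationD f g : measurable_fun setT f -> measurable_fun setT g ->
  (forall x, 0 <= f x) -> (forall x, 0 <= g x) ->
  ('E_P[f \+ g] = 'E_P[f] + 'E_P[g])%E.
Proof.
move=> mf mg f0 g0; rewrite unlock; under eq_integral do rewrite EFinD.
rewrite ge0_integralD//=; try exact/measurable_EFinP.
  by move=> x ?; exact: f0.
by move=> x ?; exact: g0.
Qed.

Lemma ge0_le_expectation f g : measurable_fun setT f -> measurable_fun setT g ->
  (forall x, 0 <= f x) -> (forall x, f x <= g x) -> ('E_P[f] <= 'E_P[g])%E.
Proof.
move=> mf mg f0 fg; apply: expectation_le => //.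
  by move=> x; exact: le_trans (fg x).
by apply/aeW => x.
Qed.

Lemma expectation_expR (f : T -> R) : measurable_fun setT f ->
  (forall x, 0 <= f x) ->
  ('E_P[fun x => expR (f x)] =
   \sum_(n <oo) 'E_P[fun x => (f x ^+ n / n`!%:R)%R])%E.
Proof.
move=> mf f0; rewrite unlock -integral_nneseries//.
- apply: eq_integral => x _.
  rewrite -EFin_lim; last exact: is_cvg_series_exp_coeff.
  by congr (limn _); apply/funext => n /=; rewrite /series/= sumEFin.
- move=> n; apply/measurable_EFinP; apply: measurable_funM => //.
  exact: measurable_funX.
- by move=> n x _; rewrite lee_fin divr_ge0// exprn_ge0.
Qed.

End Nonnegative_expectation.

Section Subgaussian.
Context d (T : measurableType d) (R : realType) (P : probability T R).
Implicit Types (f : T -> R) (v : R).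

Definition subgaussian f v : Prop := measurable_fun setT f /\
  forall l : R, ('E_P[fun x => expR (l * f x)] <= (expR (l ^+ 2 * v / 2))%:E)%E.

Lemma measurable_expR_lin f (l : R) : measurable_fun setT f ->
  measurable_fun setT (fun x => expR (l * f x)).
Proof.
by move=> mf; apply: measurableT_comp => //; exact: measurable_funM.
Qed.

Lemma measurable_cosh f (l : R) : measurable_fun setT f ->
  measurable_fun setT (fun x => expR (l * f x) + expR (- l * f x)).
Proof.
move=> mf.
exact: (measurable_funD (measurable_expR_lin l mf) (measurable_expR_lin (- l) mf)).
Qed.

Lemma subgaussian_cosh f v (a : R) : subgaussian f v ->
  ('E_P[fun x => (expR (a * f x) + expR (- a * f x))%R]
    <= (2 * expR (a ^+ 2 * v / 2))%:E)%E.
Proof.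
move=> [mf sf]; rewrite ge0_expectationD//; try exact: measurable_expR_lin.
rewrite mulr_natl mulr2n EFinD leeD//.
by have := sf (- a); rewrite sqrrN.
Qed.

(** From [x ^ (2 k) / (2 k)! <= exp |x| <= exp x + exp (- x)] at [x = a f]. The scale [12 v] leaves
    [12 ^ (- k)] because [(2 k)! / k!] is a falling factorial, at most [(2 k) ^ k]; the exponential
    contributes [exp k <= 4 ^ k], and [4 / 12 = 1 / 3] is the ratio of the geometric series summed
    next. *)
Lemma subgaussian_moment f v k : 0 < v -> subgaussian f v -> (0 < k)%N ->
  ('E_P[fun x => ((f x ^+ 2 / (12 * v)) ^+ k / k`!%:R)%R]
    <= (2 * 3^-1 ^+ k)%:E)%E.
Proof.
move=> v0 sf k0; have [mf _] := sf.
have k0' : 0 < k%:R :> R by rewrite ltr0n.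
(* This [a] minimizes [expR (a ^+ 2 * v / 2) / a ^+ (2 * k)]. *)
pose a : R := Num.sqrt (2 * k%:R / v).
have a2 : a ^+ 2 = 2 * k%:R / v.
  by rewrite sqr_sqrtr// divr_ge0 ?mulr_ge0// ltW.
pose C : R := (2 * k)`!%:R / (k`!%:R * (24 * k%:R) ^+ k).
have f0 : 0 < (k`!%:R : R) by rewrite ltr0n fact_gt0.
have f20 : 0 < ((2 * k)`!%:R : R) by rewrite ltr0n fact_gt0.
have C0 : 0 <= C by rewrite divr_ge0// ?mulr_ge0// ?exprn_ge0 ?mulr_ge0// ltW.
have C12 : C <= 12^-1 ^+ k.
  rewrite /C ler_pdivrMr ?mulr_gt0 ?exprn_gt0 ?mulr_gt0//.
  rewrite mulrCA -exprMn (_ : 12^-1 * (24 * k%:R) = (2 * k)%:R :> R); last first.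
    by rewrite natrM mulrA; congr (_ * _); lra.
  rewrite -natrX -natrM ler_nat -(@ffact_fact (2 * k) k) ?leq_pmull//.
  rewrite mul2n -addnn addnK mulnC leq_mul2l; apply/orP; right.
  exact: ffact_le_expn.
have pt x : (f x ^+ 2 / (12 * v)) ^+ k / k`!%:R
    <= C * (expR (a * f x) + expR (- a * f x)).
  have h : `|a * f x| ^+ (2 * k) <= (2 * k)`!%:R * expR `|a * f x|.
    rewrite [leRHS]mulrC -ler_pdivrMr//.
    exact: exprn_fact_le_expR (normr_ge0 _).
  have h2 : expR `|a * f x| <= expR (a * f x) + expR (- a * f x).
    rewrite mulNr; have [af|af] := leP 0 (a * f x).
      by rewrite ger0_norm// lerDl expR_ge0.
    by rewrite ltr0_norm// lerDr expR_ge0.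
  have e1 : `|a * f x| ^+ (2 * k) = (24 * k%:R) ^+ k * (f x ^+ 2 / (12 * v)) ^+ k.
    rewrite exprM real_normK ?num_real// [(a * f x) ^+ 2]exprMn a2 -[RHS]exprMn; congr (_ ^+ _).
    field; lra.
  have D0 : 0 < k`!%:R * (24 * k%:R) ^+ k :> R.
    by rewrite mulr_gt0// exprn_gt0// mulr_gt0.
  have -> : (f x ^+ 2 / (12 * v)) ^+ k / k`!%:R =
      `|a * f x| ^+ (2 * k) / (k`!%:R * (24 * k%:R) ^+ k).
    rewrite e1; field; rewrite !lt0r_neq0// ?exprn_gt0// ?mulr_gt0//.
  rewrite /C [leRHS]mulrAC ler_pM2r ?invr_gt0//.
  by apply: le_trans h _; rewrite ler_pM2l.
apply: (@le_trans _ _ 'E_P[fun x => (C * (expR (a * f x) + expR (- a * f x)))%R]%E).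
  apply: ge0_le_expectation => //.
  - apply: measurable_funM => //; apply: measurable_funX.
    by apply: measurable_funM => //; exact: measurable_funX.
  - apply: measurable_funM => //.
    exact: measurable_cosh.
  - move=> x; rewrite divr_ge0// exprn_ge0// divr_ge0 ?sqr_ge0// mulr_ge0//.
    exact: ltW.
have c0 x : 0 <= expR (a * f x) + expR (- a * f x).
  by rewrite addr_ge0// expR_ge0.
rewrite (ge0_expectationZl _ (measurable_cosh a mf) c0 C0).
apply: (@le_trans _ _ (C%:E * (2 * expR (a ^+ 2 * v / 2))%:E)%E).
  by rewrite lee_wpmul2l// ?lee_fin//; exact: subgaussian_cosh.
rewrite -EFinM lee_fin a2.
have -> : 2 * k%:R / v * v / 2 = k%:R * 1 by field; lra.
rewrite expRM_natl mulrCA ler_pM2l//.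
apply: (@le_trans _ _ (12^-1 ^+ k * 4 ^+ k)).
  apply: ler_pM => //.
  by apply: lerXn2r; rewrite ?nnegrE ?expR_ge0 ?expR1_le4.
by rewrite -exprMn (_ : 12^-1 * 4 = 3^-1 :> R)//; lra.
Qed.

Lemma subgaussian_exp_sqr f v : 0 < v -> subgaussian f v ->
  ('E_P[fun x => expR (f x ^+ 2 / (12 * v))] <= 2%:E)%E.
Proof.
move=> v0 sf; have [mf _] := sf.
have f0 x : 0 <= f x ^+ 2 / (12 * v).
  by rewrite divr_ge0 ?sqr_ge0// mulr_ge0// ltW.
rewrite expectation_expR//; last first.
  by apply: measurable_funM => //; exact: measurable_funX.
apply: lime_le.
  apply: is_cvg_nneseries => n _ _; apply: expectation_ge0 => x.
  by rewrite divr_ge0// exprn_ge0.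
apply: nearW => -[|n]; first by rewrite big_nil.
(* The first [n + 1] terms sum to at most [1 + 2 (1/3 + ... + 1/3^n) = 2 - 1/3^n]. *)
apply: (@le_trans _ _ (2 - 3^-1 ^+ n)%:E); last first.
  by rewrite lee_fin gerBl exprn_ge0.
elim: n => [|n IH].
  rewrite big_nat1 expr0 (_ : (fun x => _) = cst 1); last first.
    by apply/funext => x /=; rewrite expr0 fact0 divr1.
  by rewrite expectation_cst lee_fin; lra.
rewrite big_nat_recr//=.
apply: (@le_trans _ _ ((2 - 3^-1 ^+ n)%:E + (2 * 3^-1 ^+ n.+1)%:E)%E).
  by apply: leeD => //; exact: subgaussian_moment.
rewrite -EFinD lee_fin exprS; lra.
Qed.

End Subgaussian.

Section Subgaussian_square.
Context d (T : measurableType d) (R : realType) (P : probability T R).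
Variables (f : T -> R) (v w : R).
Hypotheses (v_gt0 : 0 < v) (sub_f : subgaussian P f v).
Hypothesis f_moment2 : ('E_P[fun x => (f x ^+ 2)%R] = w%:E)%E.

Let mf : measurable_fun setT f. Proof. by case: sub_f. Qed.

Let mf2 : measurable_fun setT (fun x => f x ^+ 2).
Proof. exact: measurable_funX. Qed.

Let w_ge0 : 0 <= w.
Proof.
by rewrite -lee_fin -f_moment2 expectation_ge0// => x; exact: sqr_ge0.
Qed.

Let mexp : measurable_fun setT (fun x => expR (f x ^+ 2 / (12 * v))).
Proof. by apply: measurableT_comp => //; exact: measurable_funM. Qed.

(** Integrate [1 + x <= expR x] at [x = f ^ 2 / (12 v)]. Centering a square by [w] then costs only
    one factor [exp 1] at this scale. *)
Lemma subgaussian_moment2_le : w <= 12 * v.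
Proof.
have v12 : 0 < 12 * v by rewrite mulr_gt0.
have mS : measurable_fun setT (fun x => (12 * v)^-1 * f x ^+ 2).
  by apply: measurable_funM.
have S0 x : 0 <= (12 * v)^-1 * f x ^+ 2.
  by apply: mulr_ge0; rewrite ?sqr_ge0// invr_ge0 ltW.
suff : (((12 * v)^-1 * w)%R%:E + 1%R%:E <= 2%R%:E)%E.
  by rewrite -EFinD lee_fin mulrC -lerBrDr ler_pdivrMr//; lra.
have f20 x : 0 <= f x ^+ 2 by exact: sqr_ge0.
rewrite EFinM -f_moment2 -ge0_expectationZl//; last by rewrite invr_ge0 ltW.
rewrite -(expectation_cst P 1) -ge0_expectationD//.
apply: le_trans (subgaussian_exp_sqr v_gt0 sub_f).
apply: ge0_le_expectation => //.
- exact: measurable_funD.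
- by move=> x; rewrite addr_ge0.
- by move=> x; rewrite /= addrC mulrC expR_ge1Dx.
Qed.

(** With [X = f ^ 2 - w], the factors [X ^ 2] and [exp |l X|] of the Taylor remainder are each
    absorbed by [exp (|X| / (24 v))]. Their product lives at the scale [12 v], where the exponential
    moment is at most 2. The constant is [96 ^ 2 = 4 * (2 * 24) ^ 2], the leading 4 being the bound
    on [exp 1] that pays for the centering. *)
Lemma subgaussian_sqr_mgf (l : R) : `|l| <= (24 * v)^-1 ->
  ('E_P[fun x => expR (l * (f x ^+ 2 - w))]
    <= (expR (2 * (96 * (l * v)) ^+ 2))%:E)%E.
Proof.
move=> lv; set c := (96 * (l * v)) ^+ 2.
have c0 : 0 <= c by exact: sqr_ge0.
pose q x := c * expR (f x ^+ 2 / (12 * v)).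
have q0 x : 0 <= q x by rewrite /q mulr_ge0// expR_ge0.
have mq : measurable_fun setT q by exact: measurable_funM.
have Eq : ('E_P[q] <= (2 * c)%:E)%E.
  rewrite ge0_expectationZl//.
  apply: (@le_trans _ _ (c%:E * 2%:E)%E); last by rewrite -EFinM lee_fin mulrC.
  by apply: lee_wpmul2l => //; exact: subgaussian_exp_sqr.
have pt x : expR (l * (f x ^+ 2 - w)) <= 1 + l * (f x ^+ 2 - w) + q x.
  apply: le_trans (expR_le_quadratic _) _; rewrite lerD2l /q.
  set X := f x ^+ 2 - w.
  have v24 : 0 < (24 * v) by rewrite mulr_gt0.
  set e := expR (`|X| / (24 * v)).
  have h1 : X ^+ 2 <= (48 * v) ^+ 2 * e.
    have := @sqr_le_expR _ (`|X| / (24 * v)).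
    rewrite divr_ge0 ?(ltW v24)// => /(_ isT).
    rewrite exprMn real_normK ?num_real// exprVn.
    rewrite ler_pdivrMr ?exprn_gt0// => /le_trans; apply.
    rewrite -/e; lra.
  have h2 : expR `|l * X| <= e.
    by rewrite ler_expR normrM mulrC ler_wpM2l.
  have h3 : e * e <= 4 * expR (f x ^+ 2 / (12 * v)).
    rewrite -expRD.
    apply: (@le_trans _ _ (expR (1 + f x ^+ 2 / (12 * v)))).
      have hX : `|X| <= f x ^+ 2 + w.
        by rewrite (le_trans (ler_normB _ _))// !ger0_norm// sqr_ge0.
      have w12 := subgaussian_moment2_le.
      have -> : `|X| / (24 * v) + `|X| / (24 * v) = `|X| / (12 * v).
        field; lra.
      rewrite ler_expR ler_pdivrMr ?mulr_gt0// mulrDl mulfVK; last first.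
        by rewrite lt0r_neq0// mulr_gt0.
      lra.
    by rewrite expRD ler_wpM2r ?expR_ge0 ?expR1_le4.
  have e0 : 0 <= e := expR_ge0 _.
  have step : X ^+ 2 * expR `|l * X| <= (48 * v) ^+ 2 * (4 * expR (f x ^+ 2 / (12 * v))).
    apply: (@le_trans _ _ ((48 * v) ^+ 2 * e * e)).
      by apply: ler_pM; rewrite ?sqr_ge0 ?expR_ge0.
    by rewrite -mulrA ler_wpM2l ?sqr_ge0.
  rewrite [(l * X) ^+ 2]exprMn -mulrA.
  apply: le_trans (ler_wpM2l (sqr_ge0 l) step) _.
  by rewrite le_eqVlt; apply/orP; left; apply/eqP; rewrite /c; ring.
have e1 : (1 + (2 * c)%:E <= (expR (2 * c))%:E)%E.
  by rewrite -EFinD lee_fin expR_ge1Dx.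
have mE : measurable_fun setT (fun x => expR (l * (f x ^+ 2 - w))).
  apply: measurableT_comp => //; apply: measurable_funM => //.
  exact: measurable_funB.
(* The signed term [l * (f x ^+ 2 - w)] is split so that its negative part joins
   the left-hand side: only expectations of nonnegative functions appear. *)
have addE (r : R) (a b : \bar R) : (a + r%:E <= b + r%:E)%E -> (a <= b)%E.
  by rewrite leeD2rE.
apply: le_trans e1.
have expR0' x : 0 <= expR (l * (f x ^+ 2 - w)) by exact: expR_ge0.
have [l0|l0] := leP 0 l.
  have lw0 : 0 <= l * w by exact: mulr_ge0.
  have ml : measurable_fun setT (fun x => l * f x ^+ 2) by exact: measurable_funM.
  have lf0 x : 0 <= l * f x ^+ 2 by rewrite mulr_ge0 ?sqr_ge0.
  apply: (addE (l * w)).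
  rewrite -{1}(expectation_cst P (l * w)) -ge0_expectationD//.
  apply: (@le_trans _ _ ('E_P[((cst 1 \+ (fun x => l * f x ^+ 2)) \+ q)%R])%E).
    apply: ge0_le_expectation.
    - exact: measurable_funD.
    - by apply: measurable_funD => //; exact: measurable_funD.
    - by move=> x /=; rewrite addr_ge0.
    - by move=> x /=; have := pt x; lra.
  rewrite ge0_expectationD//; last 2 first.
  - exact: measurable_funD.
  - by move=> x /=; rewrite addr_ge0.
  rewrite ge0_expectationD// expectation_cst ge0_expectationZl//; last first.
    by move=> x; exact: sqr_ge0.
  by rewrite f_moment2 -EFinM addeAC leeD2rE// leeD2lE.
have l0' : 0 <= - l by rewrite oppr_ge0 ltW.
have ml : measurable_fun setT (fun x => - l * f x ^+ 2) by exact: measurable_funM.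
have lf0 x : 0 <= - l * f x ^+ 2 by rewrite mulr_ge0 ?sqr_ge0.
have lw0 : 0 <= 1 + - l * w by rewrite addr_ge0// mulr_ge0.
apply: (addE (- l * w)).
rewrite {1}EFinM -f_moment2 -ge0_expectationZl//; last first.
  by move=> x; exact: sqr_ge0.
rewrite -ge0_expectationD//.
apply: (@le_trans _ _ ('E_P[(cst (1 + - l * w) \+ q)%R])%E).
  apply: ge0_le_expectation.
  - exact: measurable_funD.
  - exact: measurable_funD.
  - by move=> x /=; rewrite addr_ge0.
  - by move=> x /=; have := pt x; lra.
rewrite ge0_expectationD// expectation_cst EFinD addeAC leeD2rE//.
by rewrite leeD2lE.
Qed.

End Subgaussian_square.

(** * Tail bounds for sums over disjoint blocks of independent variables *)

Section Chernoff.
Context d (T : measurableType d) (R : realType) (P : probability T R).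

Lemma chernoff_le (f : T -> R) (r a c : R) : measurable_fun setT f -> 0 < r ->
  ('E_P[fun x => expR (r * f x)] <= (expR c)%:E)%E ->
  (P [set x | (a <= f x)%R] <= (expR (c - r * a))%:E)%E.
Proof.
move=> mf r0 Ef.
pose fm : {mfun T >-> R} := HB.pack f (isMeasurableFun.Build _ _ _ _ _ mf).
have := @chernoff _ _ _ P fm r a r0; rewrite /mmt_gen_fun => /le_trans; apply.
rewrite expRD EFinM lee_wpmul2r ?lee_fin ?expR_ge0//.
apply: le_trans Ef; rewrite le_eqVlt; apply/orP; left; apply/eqP.
by congr expectation; apply/funext => x /=; rewrite mulrC.
Qed.

Lemma measurable_set_ge (f : T -> R) (a : R) : measurable_fun setT f ->
  measurable [set x | a <= f x].
Proof.
move=> mf; rewrite (_ : [set x | _] = f @^-1` `[a, +oo[); last first.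
  by apply/seteqP; split => x /=; rewrite in_itv/= andbT.
by rewrite -[X in measurable X]setTI; exact: mf.
Qed.

Lemma measurable_set_gt (f : T -> R) (a : R) : measurable_fun setT f ->
  measurable [set x | a < f x].
Proof.
move=> mf; rewrite (_ : [set x | _] = f @^-1` `]a, +oo[); last first.
  by apply/seteqP; split => x /=; rewrite in_itv/= andbT.
by rewrite -[X in measurable X]setTI; exact: mf.
Qed.

Lemma two_sided_tail (f : T -> R) (a c : R) : measurable_fun setT f ->
  (P [set x | (a <= f x)%R] <= c%:E)%E -> (P [set x | (a <= - f x)%R] <= c%:E)%E ->
  (P [set x | (a <= `|f x|)%R] <= (2 * c)%:E)%E.
Proof.
move=> mf Pf Pnf.
have mA : measurable [set x | a <= f x] by exact: measurable_set_ge.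
have mB : measurable [set x | a <= - f x].
  by apply: measurable_set_ge; exact: measurable_funN.
have -> : [set x | (a <= `|f x|)%R] = [set x | a <= f x] `|` [set x | a <= - f x].
  apply/seteqP; split => x /=.
    by rewrite real_ler_normr ?num_real// => /orP[]; [left|right].
  by move=> h; rewrite real_ler_normr ?num_real//; apply/orP; case: h; [left|right].
apply: le_trans (measureU2 _ _ _) _ => //.
by rewrite mulr_natl mulr2n EFinD leeD.
Qed.

Lemma subgaussian_tail (f : T -> R) (v a : R) : 0 < v -> 0 <= a ->
  subgaussian P f v ->
  (P [set x | (a <= `|f x|)%R] <= (2 * expR (- (a ^+ 2 / (2 * v))))%:E)%E.
Proof.
move=> v0; rewrite le_eqVlt => /orP[/eqP <-|a0] [mf sf].
  rewrite expr0n mul0r oppr0 expR0 mulr1.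
  apply: le_trans (probability_le1 _ _) _; last by rewrite lee_fin ler1n.
  by apply: measurable_set_ge; exact: measurableT_comp.
(* [r = a / v] minimizes [r ^ 2 * v / 2 - r * a]; it is positive because [a = 0] has been treated
   apart. *)
have r0 : 0 < a / v by rewrite divr_gt0.
have e : - (a ^+ 2 / (2 * v)) = (a / v) ^+ 2 * v / 2 - a / v * a by field; lra.
apply: two_sided_tail => //; rewrite e; apply: chernoff_le => //.
  exact: measurable_funN.
under eq_fun do rewrite mulrN -mulNr.
by rewrite -sqrrN; exact: sf.
Qed.

End Chernoff.

Section Concentration.
Context d (T : measurableType d) (R : realType) (P : probability T R).
Context d' (T' : measurableType d') (I : finType) (X : I -> {RV P >-> T'}).
Hypothesis indepX : mutually_independent X.
Variables (G : finType) (A : {pred G}) (J : G -> {set I}).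
Hypothesis disjJ : forall g h, g \in A -> h \in A -> g != h ->
  [disjoint J g & J h]%B.

(** Blocks instead of single indices let the same argument serve the samples (singletons) and the
    class sums (whole cells). *)
Lemma expectation_prod_le (F : G -> T -> R) (c : G -> R) :
  (forall g, g \in A -> adapted X (J g) (F g)) ->
  (forall g x, 0 <= F g x) ->
  (forall g, g \in A -> ('E_P[F g] <= (c g)%:E)%E) ->
  ('E_P[fun x => (\prod_(g in A) F g x)%R] <= (\prod_(g in A) c g)%:E)%E.
Proof.
move=> aF F0 Fc; under eq_fun do rewrite -big_enum; rewrite -big_enum.
have mA g : g \in enum A -> g \in A by rewrite mem_enum.
rewrite (ge0_expectation_prod_adapted indepX (enum_uniq A) (J := J))//; last 2 first.
- by move=> g h /mA gA /mA hA; exact: disjJ.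
- by move=> g /mA; exact: aF.
elim: (enum A) mA => [|g s IH] sA; first by rewrite !big_nil.
rewrite !big_cons EFinM.
apply: lee_pmul.
- by apply: expectation_ge0 => x.
- by apply: prode_ge0 => h _; apply: expectation_ge0 => x.
- by apply: Fc; apply: sA; exact: mem_head.
- by apply: IH => h hs; apply: sA; rewrite inE hs orbT.
Qed.

Variable V : G -> T -> R.
Hypothesis adV : forall g, g \in A -> adapted X (J g) (V g).

Lemma measurable_sum_adapted : measurable_fun setT (fun x => \sum_(g in A) V g x).
Proof.
under eq_fun do rewrite -big_enum; apply: (@adapted_measurable _ _ _ _ _ _ _ X [set: I]%SET).
apply: adapted_sum => g; rewrite mem_enum => gA.
by apply: adapted_sub (adV gA); exact: finset.subsetT.
Qed.

Lemma subgaussian_sum (v : G -> R) :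
  (forall g, g \in A -> subgaussian P (V g) (v g)) ->
  subgaussian P (fun x => \sum_(g in A) V g x) (\sum_(g in A) v g).
Proof.
move=> sV; split; first exact: measurable_sum_adapted.
move=> l; under eq_fun do rewrite mulr_sumr expR_sum.
rewrite mulr_sumr mulr_suml expR_sum.
apply: expectation_prod_le.
- move=> g gA; apply: (adapted_measurable_comp (h := fun y => expR (l * y))) (adV gA).
  by apply: measurable_expR_lin.
- by move=> g x; exact: expR_ge0.
- by move=> g gA; have [_] := sV _ gA; exact.
Qed.

(* [N] may exceed the number of summands: the class sums, which are fewer than
   the samples, are compared with the same sample size. *)
Lemma sum_sqr_tail (v w N t : R) : 0 < v ->
  (forall g, g \in A -> subgaussian P (V g) v) ->
  (forall g, g \in A -> ('E_P[fun x => (V g x ^+ 2)%R] = w%:E)%E) ->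
  #|A|%:R <= N -> 0 < t <= 1 ->
  (P [set x | (t * N * v <= `|\sum_(g in A) (V g x ^+ 2 - w)|)%R]
    <= (2 * expR (- ((t / 192) ^+ 2 * N / 2)))%:E)%E.
Proof.
move=> v0 sV mV AN /andP[t0 t1].
have adV2 g : g \in A -> adapted X (J g) (fun x => V g x ^+ 2 - w).
  move=> gA; apply: (adapted_measurable_comp (h := fun y => y ^+ 2 - w)) (adV gA).
  by apply: measurable_funB => //; exact: measurable_funX.
have mS : measurable_fun setT (fun x => \sum_(g in A) (V g x ^+ 2 - w)).
  under eq_fun do rewrite -big_enum; apply: (@adapted_measurable _ _ _ _ _ _ _ X [set: I]%SET).
  apply: adapted_sum => g; rewrite mem_enum => gA.
  by apply: adapted_sub (adV2 _ gA); exact: finset.subsetT.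
(* The minimizer of the Chernoff exponent [2 * (96 * r * v) ^ 2 * N - r * t * N * v]; the condition
   [t <= 1] keeps it below [1 / (24 * v)], where the moment bound holds. *)
pose r := t / (192 ^+ 2 * v).
have r0 : 0 < r by rewrite divr_gt0// mulr_gt0// exprn_gt0.
have main l : `|l| = r ->
    ('E_P[fun x => expR (l * \sum_(g in A) (V g x ^+ 2 - w))]
      <= (expR (2 * (96 * (r * v)) ^+ 2 * N))%:E)%E.
  move=> lr; under eq_fun do rewrite mulr_sumr expR_sum.
  apply: (@le_trans _ _ (\prod_(g in A) expR (2 * (96 * (l * v)) ^+ 2))%:E).
    apply: expectation_prod_le.
    - move=> g gA; apply: (adapted_measurable_comp (h := fun y => expR (l * y))) (adV2 _ gA).
      by apply: measurable_expR_lin.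
    - by move=> g x; exact: expR_ge0.
    - move=> g gA; apply: subgaussian_sqr_mgf => //; first exact: sV.
        exact: mV.
      rewrite lr /r ler_pdivrMr; last by rewrite mulr_gt0// exprn_gt0.
      have -> : (24 * v)^-1 * (192 ^+ 2 * v) = 8 * 192 by field; lra.
      lra.
  have -> : (96 * (l * v)) ^+ 2 = (96 * (r * v)) ^+ 2.
    transitivity (l ^+ 2 * (96 * v) ^+ 2); first by ring.
    by rewrite -[l ^+ 2]real_normK ?num_real// lr; ring.
  rewrite -expR_sum lee_fin ler_expR sumr_const -[leLHS]mulr_natr.
  by rewrite ler_wpM2l// mulr_ge0 ?ler0n ?sqr_ge0.
have e : - ((t / 192) ^+ 2 * N / 2) = 2 * (96 * (r * v)) ^+ 2 * N - r * (t * N * v).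
  by rewrite /r; field; lra.
apply: two_sided_tail => //; rewrite e; apply: chernoff_le => //.
- by apply: main; rewrite ger0_norm// ltW.
- exact: measurable_funN.
under eq_fun do rewrite mulrN -mulNr.
by apply: main; rewrite normrN ger0_norm// ltW.
Qed.

End Concentration.

Section Second_moments.
Context d (T : measurableType d) (R : realType) (P : probability T R).

Lemma Lfun1D (f g : T -> R) :
  f \in Lfun P 1 -> g \in Lfun P 1 -> f \+ g \in Lfun P 1.
Proof. by move=> fL gL; rewrite rpredD. Qed.

Lemma Lfun1_of_expectation_sqr (f : T -> R) (w : R) : measurable_fun setT f ->
  ('E_P[fun x => (f x ^+ 2)%R] = w%:E)%E -> (fun x => f x ^+ 2) \in Lfun P 1.
Proof.
move=> mf fw; apply/Lfun1_integrable/integrableP; split.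
  by apply/measurable_EFinP; exact: measurable_funX.
under eq_integral => x _ do rewrite /= ger0_norm ?sqr_ge0//.
by move: fw; rewrite unlock => ->; rewrite ltry.
Qed.

Lemma Lfun1_mul_of_sqr (f g : T -> R) :
  measurable_fun setT f -> measurable_fun setT g ->
  (fun x => f x ^+ 2) \in Lfun P 1 -> (fun x => g x ^+ 2) \in Lfun P 1 ->
  f \* g \in Lfun P 1.
Proof.
move=> mf mg f2 g2; have fg2 := Lfun1D f2 g2.
move: (fg2) => /Lfun1_integrable fg2i; apply/Lfun1_integrable.
apply: le_integrable fg2i => //.
  by apply/measurable_EFinP; exact: measurable_funM.
move=> x _ /=; rewrite lee_fin normrM (ger0_norm (addr_ge0 (sqr_ge0 _) (sqr_ge0 _))).
rewrite -(real_normK (num_real (f x))) -(real_normK (num_real (g x))).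
have := normr_ge0 (f x); have := normr_ge0 (g x).
set a := `|f x|; set b := `|g x| => b0 a0.
have := sqr_ge0 (a - b); nra.
Qed.

Lemma subgaussian_scale (f : T -> R) (v c : R) :
  subgaussian P f v -> subgaussian P (fun x => c * f x) (c ^+ 2 * v).
Proof.
move=> [mf sf]; split; first exact: measurable_funM.
move=> l; under eq_fun do rewrite mulrA.
by apply: le_trans (sf _) _; rewrite exprMn mulrA.
Qed.

Lemma expectation_lincomb (I : eqType) (s : seq I) (a e : I -> R)
    (f : I -> T -> R) :
  (forall i, f i \in Lfun P 1) -> (forall i, ('E_P[f i] = (e i)%:E)%E) ->
  (fun x => \sum_(i <- s) a i * f i x) \in Lfun P 1 /\
  ('E_P[fun x => (\sum_(i <- s) a i * f i x)%R] = (\sum_(i <- s) a i * e i)%:E)%E.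
Proof.
move=> fL fe; elim: s => [|i s [IL IE]].
  under eq_fun do rewrite big_nil; rewrite big_nil.
  by split; [exact: Lfun_cst|exact: expectation_cst].
have aL : (fun x => a i * f i x) \in Lfun P 1.
  under eq_fun do rewrite mulrC.
  exact: Lfun_scale.
under eq_fun do rewrite big_cons; rewrite big_cons; split.
  exact: (Lfun1D aL IL).
rewrite (expectationD aL IL) IE EFinD EFinM -fe; congr (_ + _)%E.
by rewrite -expectationZl//; congr expectation; apply/funext => x /=; rewrite mulrC.
Qed.

Context d' (T' : measurableType d') (I : finType) (X : I -> {RV P >-> T'}).
Hypothesis indepX : mutually_independent X.
Variables (G : finType) (A : {pred G}) (J : G -> {set I}).
Hypothesis disjJ : forall g h, g \in A -> h \in A -> g != h ->
  [disjoint J g & J h]%B.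

(** Each summand is centered and independent of the sum of the later ones, so the cross terms
    vanish. Integrability of the partial sums is part of the induction because the product rule for
    signed variables asks for it. *)
Lemma expectation_sqr_sum (V : G -> T -> R) (w : R) :
  (forall g, g \in A -> adapted X (J g) (V g)) ->
  (forall g, g \in A -> V g \in Lfun P 1) ->
  (forall g, g \in A -> ('E_P[V g] = 0)%E) ->
  (forall g, g \in A -> ('E_P[fun x => (V g x ^+ 2)%R] = w%:E)%E) ->
  ('E_P[fun x => ((\sum_(g in A) V g x) ^+ 2)%R] = (#|A|%:R * w)%:E)%E.
Proof.
move=> aV LV EV E2; under eq_fun do rewrite -big_enum; rewrite cardE.
have mA g : g \in enum A -> g \in A by rewrite mem_enum.
suff : [/\ (fun x => \sum_(g <- enum A) V g x) \in Lfun P 1,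
  ('E_P[fun x => (\sum_(g <- enum A) V g x)%R] = 0)%E &
  ('E_P[fun x => ((\sum_(g <- enum A) V g x) ^+ 2)%R] =
    ((size (enum A))%:R * w)%:E)%E] by case.
elim: (enum A) mA (enum_uniq A) => [|g s IH] sA /=.
  move=> _; under eq_fun do rewrite big_nil.
  split; [exact: Lfun_cst|exact: expectation_cst|].
  rewrite mul0r; under eq_fun do rewrite big_nil expr0n.
  exact: expectation_cst.
move=> /andP[gs us].
have sub h : h \in s -> h \in A by move=> hs; apply: sA; rewrite inE hs orbT.
have gA : g \in A by apply: sA; exact: mem_head.
have [SL SE S2] := IH sub us.
set S := fun x => \sum_(h <- s) V h x.
pose K := [set i | has (fun h => i \in J h) s]%SET.
have aS : adapted X K S.
  apply: adapted_sum => h hs; apply: adapted_sub (aV h (sub _ hs)).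
  by apply/fintype.subsetP => i iJ; rewrite inE; apply/hasP; exists h.
have gK : [disjoint J g & K]%B.
  apply/pred0Pn => -[i /andP[/= ig]]; rewrite inE => /hasP[h hs ih].
  have gh : g != h by apply: contraNneq gs => ->.
  by have /pred0Pn := disjJ gA (sub _ hs) gh; apply; exists i; rewrite /= ig.
have mV := adapted_measurable (aV _ gA).
have mS := adapted_measurable aS.
have VSL : V g \* S \in Lfun P 1.
  apply: Lfun1_mul_of_sqr => //; first exact: Lfun1_of_expectation_sqr (E2 _ gA).
  exact: Lfun1_of_expectation_sqr S2.
have VS0 : ('E_P[V g \* S] = 0)%E.
  by rewrite (expectation_indep mV mS (adapted_indep indepX gK (aV _ gA) aS))
    ?LV// EV// mul0e.
have V2L := Lfun1_of_expectation_sqr mV (E2 _ gA).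
have S2L := Lfun1_of_expectation_sqr mS S2.
have VSL2 : (fun x => (V g \* S) x * 2) \in Lfun P 1 by exact: Lfun_scale.
split.
- by under eq_fun do rewrite big_cons; exact: (Lfun1D (LV _ gA) SL).
- under eq_fun do rewrite big_cons.
  by rewrite (expectationD (LV _ gA) SL) EV// SE adde0.
have -> : (fun x => (\sum_(h <- g :: s) V h x) ^+ 2) =
    ((fun x => S x ^+ 2) \+ ((fun x => V g x ^+ 2) \+ (fun x => (V g \* S) x * 2))).
  by apply/funext => x /=; rewrite big_cons /S; ring.
rewrite (expectationD S2L (Lfun1D V2L VSL2)) (expectationD V2L VSL2).
rewrite (expectationZl 2 VSL) VS0 mule0 adde0 S2 E2// -EFinD.
by rewrite -natr1; congr EFin; ring.
Qed.

End Second_moments.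

(** * Linear and quadratic forms, and their moments under the law of one class *)

Section Trace_inner_product.
Context (R : realType) (m n : nat).
Implicit Types U V W : 'M[R]_(m, n).

Lemma mxdotC V W : mxdot V W = mxdot W V.
Proof. by rewrite /mxdot -mxtrace_tr trmx_mul trmxK. Qed.

Lemma mxdotDl U V W : mxdot (U + V) W = mxdot U W + mxdot V W.
Proof. by rewrite /mxdot linearD mulmxDl mxtraceD. Qed.

Lemma mxdotDr U V W : mxdot W (U + V) = mxdot W U + mxdot W V.
Proof. by rewrite /mxdot mulmxDr mxtraceD. Qed.

Lemma mxdotNr V W : mxdot V (- W) = - mxdot V W.
Proof. by rewrite /mxdot mulmxN raddfN. Qed.

Lemma mxdotBr U V W : mxdot W (U - V) = mxdot W U - mxdot W V.
Proof. by rewrite mxdotDr mxdotNr. Qed.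

Lemma mxdotZl (h : R) V W : mxdot (h *: V) W = h * mxdot V W.
Proof. by rewrite /mxdot linearZ/= -scalemxAl mxtraceZ. Qed.

Lemma mxdotZr (h : R) V W : mxdot V (h *: W) = h * mxdot V W.
Proof. by rewrite /mxdot -scalemxAr mxtraceZ. Qed.

Lemma mxdot_sumr (I : Type) (r : seq I) (p : pred I) V (F : I -> 'M[R]_(m, n)) :
  mxdot V (\sum_(i <- r | p i) F i) = \sum_(i <- r | p i) mxdot V (F i).
Proof. by rewrite /mxdot mulmx_sumr raddf_sum. Qed.

End Trace_inner_product.

Section Linear_forms.
Context (R : realType) (d : nat).
Implicit Types (S : 'M[R]_d) (u v : 'cV[R]_d).

Definition bform S u v : R := (u^T *m S *m v) 0 0.

Lemma mxdotE u v : mxdot u v = \sum_j u j 0 * v j 0.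
Proof.
by rewrite /mxdot /mxtrace big_ord1 mxE; apply: eq_bigr => j _; rewrite mxE.
Qed.

Lemma bformE S u v : bform S u v = \sum_j \sum_l u j 0 * S j l * v l 0.
Proof.
rewrite /bform -mulmxA mxE; apply: eq_bigr => j _; rewrite !mxE mulr_sumr.
by apply: eq_bigr => l _; rewrite mulrA.
Qed.

Lemma is_inv_sqrtmx_bform S (A : 'M[R]_d) u : S \in unitmx -> is_inv_sqrtmx S A ->
  A \in unitmx /\ bform S u u = mxdot (invmx A *m u) (invmx A *m u).
Proof.
move=> uS [[sA _] AA].
have uA : A \in unitmx.
  have : A *m A \in unitmx by rewrite AA unitmx_inv.
  by rewrite unitmx_mul => /andP[].
split=> //.
have SE : S = invmx A *m invmx A.
  have h : A *m (A *m S) = 1%:M by rewrite mulmxA AA mulVmx.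
  by rewrite -[RHS]mulmx1 -h -mulmxA !mulKmx.
have -> : mxdot (invmx A *m u) (invmx A *m u) =
    ((invmx A *m u)^T *m (invmx A *m u)) 0 0.
  by rewrite /mxdot /mxtrace big_ord1.
by rewrite /bform SE trmx_mul trmx_inv sA !mulmxA.
Qed.

Lemma mxdot_sqr u : mxdot u u = \sum_j u j 0 ^+ 2.
Proof. by rewrite mxdotE; apply: eq_bigr => j _; rewrite expr2. Qed.

Lemma mxdot_gt0 u : u != 0 -> 0 < mxdot u u.
Proof.
move=> u0; rewrite lt_neqAle mxdot_sqr sumr_ge0 ?andbT; last first.
  by move=> j _; exact: sqr_ge0.
apply: contraNN u0; rewrite eq_sym psumr_eq0; last by move=> j _; exact: sqr_ge0.
move=> /allP u0; apply/eqP/matrixP => i j; rewrite ord1 mxE.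
by have := u0 i (mem_index_enum _); rewrite /= sqrf_eq0 => /eqP.
Qed.

End Linear_forms.

Section Population_law.
Context (R : realType) (d : nat) (Q : probability (d.-tuple R) R).
Variables (mu : 'cV[R]_d) (S : 'M[R]_d).
Hypotheses (S_unit : S \in unitmx) (Q_mean_cov : has_mean_cov Q mu S).
Variable sigma2 : R.
Hypothesis Q_sub : sub_gaussian sigma2 Q mu S.

(** Positivity comes from the square root in the sub-Gaussian condition: [S] is the square of the
    symmetric invertible matrix [invmx A]. *)
Lemma bform_gt0 (u : 'cV[R]_d) : u != 0 -> 0 < bform S u u.
Proof.
move=> u0; have [A SA _] := Q_sub.
have [uA ->] := is_inv_sqrtmx_bform u S_unit SA.
apply: mxdot_gt0; apply: contra_neq u0 => h.
by rewrite -(mulKVmx uA u) h mulmx0.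
Qed.

Lemma bform_ge0 (u : 'cV[R]_d) : 0 <= bform S u u.
Proof.
have [->|/bform_gt0/ltW//] := eqVneq u 0.
by rewrite /bform mulmx0 mxE.
Qed.

Lemma has_mean_cov_sym : S^T = S.
Proof.
have [_ _ cov] := Q_mean_cov; apply/matrixP => i j; rewrite mxE.
by have := cov i j; rewrite covarianceC cov => -[].
Qed.

Let centered j (x : d.-tuple R) := tnth x j - mu j 0.

Lemma measurable_proj_centered (u : 'cV[R]_d) :
  measurable_fun setT (fun x : d.-tuple R => mxdot u (col_of_tuple x - mu)).
Proof.
under eq_fun do rewrite mxdotE.
apply: measurable_sum => j; apply: measurable_funM => //.
under eq_fun do rewrite !mxE.
by apply: measurable_funB => //; exact: measurable_tnth.
Qed.

Lemma proj_centeredE (u : 'cV[R]_d) x :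
  mxdot u (col_of_tuple x - mu) = \sum_j u j 0 * centered j x.
Proof. by rewrite mxdotE; apply: eq_bigr => j _; rewrite !mxE. Qed.

(** The whitened condition is used in the unit direction proportional to [S^{1/2} u], the norm
    [sqrt (bform S u u)] of that vector being moved into the parameter [l]. *)
Lemma sub_gaussian_proj (u : 'cV[R]_d) :
  subgaussian Q (fun x => mxdot u (col_of_tuple x - mu)) (sigma2 * bform S u u).
Proof.
split; first exact: measurable_proj_centered.
move=> l; have [->|u0] := eqVneq u 0.
  rewrite /bform mulmx0 mxE mulr0 mulr0 mul0r expR0.
  under eq_fun do rewrite /mxdot trmx0 mul0mx mxtrace0 mulr0 expR0.
  by rewrite (expectation_cst Q 1).
have q0 := bform_gt0 u0; set q := bform S u u in q0 *.
have [A SA Qsub] := Q_sub.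
have [uA qE] := is_inv_sqrtmx_bform u S_unit SA; rewrite -/q in qE.
have sA : A^T = A by case: SA => -[].
pose v := (Num.sqrt q)^-1 *: (invmx A *m u).
have sq0 : Num.sqrt q != 0 by rewrite sqrtr_eq0 -ltNge.
have v1 : vnorm 2 (fun j => v j 0) = 1.
  rewrite vnorm2E -mxdot_sqr /v mxdotZl mxdotZr -qE mulrA -expr2.
  rewrite exprVn sqr_sqrtr ?ltW// mulVf ?lt0r_neq0//.
  by rewrite sqrtr1.
have := Qsub (l * Num.sqrt q) v v1.
have -> : (l * Num.sqrt q) ^+ 2 * sigma2 / 2 = l ^+ 2 * (sigma2 * q) / 2.
  by rewrite exprMn sqr_sqrtr ?ltW//; lra.
have -> : (fun x : d.-tuple R => expR (l * Num.sqrt q * mxdot v (A *m (col_of_tuple x - mu))))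
   = (fun x => expR (l * mxdot u (col_of_tuple x - mu))).
  apply/funext => x; congr expR; rewrite -mulrA; congr (_ * _).
  rewrite /v mxdotZl mulrA mulfV// mul1r.
  by rewrite /mxdot trmx_mul trmx_inv sA -mulmxA mulKmx.
by [].
Qed.

Let Lcentered2 j : centered j \in Lfun Q 2%:E.
Proof.
have [L2 _ _] := Q_mean_cov.
have -> : centered j = (fun x => tnth x j) \- cst (mu j 0) by [].
rewrite rpredB//; first by rewrite lee1n.
by move=> h12; exact: L2.
by move=> h12; exact: Lfun_cst.
Qed.

Let Ecentered j : ('E_Q[centered j] = 0%:E)%E.
Proof.
have [L2 EQ _] := Q_mean_cov.
have L1 : (fun x : d.-tuple R => tnth x j) \in Lfun Q 1.
  by apply: Lfun_subset12 => //; exact: fin_num_measure.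
rewrite (expectationB L1 (Lfun_cst _ _ _)) EQ expectation_cst.
by rewrite -EFinB subrr.
Qed.

Lemma proj_centered_Lfun1 (u : 'cV[R]_d) :
  (fun x => mxdot u (col_of_tuple x - mu)) \in Lfun Q 1 /\
  ('E_Q[fun x => (mxdot u (col_of_tuple x - mu))%R] = 0)%E.
Proof.
have L1 j : centered j \in Lfun Q 1.
  by apply: Lfun_subset12 => //; exact: fin_num_measure.
have [L E] := expectation_lincomb (index_enum 'I_d) (fun j => u j 0) L1 Ecentered.
under eq_fun do rewrite proj_centeredE; split=> //.
by rewrite E big1// => j _; rewrite mulr0.
Qed.

Lemma expectation_proj_centered_sqr (u : 'cV[R]_d) :
  ('E_Q[fun x => (mxdot u (col_of_tuple x - mu) ^+ 2)%R] = (bform S u u)%:E)%E.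
Proof.
have [_ EQ cov] := Q_mean_cov.
pose f (p : 'I_d * 'I_d) := centered p.1 \* centered p.2.
have fL p : f p \in Lfun Q 1 by exact: Lfun2_mul_Lfun1.
have fE p : ('E_Q[f p] = (S p.1 p.2)%:E)%E.
  by rewrite -cov [in RHS]unlock !EQ.
have [_ h] := expectation_lincomb (index_enum _) (fun p => u p.1 0 * u p.2 0) fL fE.
rewrite bformE pair_big /=.
have -> : \sum_p u p.1 0 * S p.1 p.2 * u p.2 0 =
    \sum_p u p.1 0 * u p.2 0 * S p.1 p.2 by apply: eq_bigr => p _; rewrite mulrAC.
rewrite -h; congr expectation; apply/funext => x.
rewrite proj_centeredE expr2 big_distrlr/= pair_big/=.
by apply: eq_bigr => p _; rewrite /f/=; ring.
Qed.

End Population_law.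

(** * Pooled covariance and class means *)

Section Pooled_identities.
Context (R : realType) (d : nat).
Implicit Types u v : 'cV[R]_d.

Lemma bformZ (c : R) (S : 'M[R]_d) u v : bform (c *: S) u v = c * bform S u v.
Proof. by rewrite /bform -scalemxAr -scalemxAl mxE. Qed.

Lemma bformD (S S' : 'M[R]_d) u v : bform (S + S') u v = bform S u v + bform S' u v.
Proof. by rewrite /bform mulmxDr mulmxDl mxE. Qed.

Lemma bform_sum (I : Type) (r : seq I) (p : pred I) (F : I -> 'M[R]_d) u v :
  bform (\sum_(i <- r | p i) F i) u v = \sum_(i <- r | p i) bform (F i) u v.
Proof. by rewrite /bform mulmx_sumr mulmx_suml summxE. Qed.

Lemma bform_outer u v : bform (v *m v^T) u u = mxdot u v ^+ 2.
Proof.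
have -> : mxdot u v = (u^T *m v) 0 0 by rewrite /mxdot /mxtrace big_ord1.
rewrite /bform mulmxA -mulmxA (_ : v^T *m u = (u^T *m v)^T).
  by rewrite mxE big_ord1 [_^T 0 0]mxE expr2.
by rewrite trmx_mul trmxK.
Qed.

Context (K b : nat) (b_gt0 : (0 < b)%N).
Variables (y : 'I_(K * b) -> 'I_K) (x : 'I_(K * b) -> 'cV[R]_d).
Hypothesis y_bal : balanced_labels y.

Lemma balanced_card k : #|[pred i | y i == k]| = b.
Proof. by rewrite -cardsE; exact: y_bal. Qed.

Lemma class_mean_subE (k : 'I_K) (m : 'cV[R]_d) :
  class_mean y x k - m = b%:R^-1 *: \sum_(i | y i == k) (x i - m).
Proof.
rewrite sumrB scalerBr; congr (_ - _); rewrite sumr_const.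
rewrite balanced_card -(scaler_nat b m) scalerA mulVf ?scale1r//.
by rewrite pnatr_eq0 -lt0n.
Qed.

Lemma bform_pooled_cov (mu : 'I_K -> 'cV[R]_d) u :
  bform (pooled_cov y x) u u = ((K * b)%:R - K%:R)^-1 *
    (\sum_i mxdot u (x i - mu (y i)) ^+ 2
     - \sum_k b%:R^-1 * (\sum_(i | y i == k) mxdot u (x i - mu k)) ^+ 2).
Proof.
have b0 : b%:R != 0 :> R by rewrite pnatr_eq0 -lt0n.
rewrite /pooled_cov bformZ bform_sum; congr (_ * _).
rewrite (partition_big y predT)//= -sumrB; apply: eq_bigr => k _.
rewrite bform_sum.
set A := \sum_(i | y i == k) mxdot u (x i - mu k).
have e i : y i == k -> bform ((x i - class_mean y x k) *m (x i - class_mean y x k)^T) u u =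
    mxdot u (x i - mu (y i)) ^+ 2 + ((b%:R^-1 * A) ^+ 2 - 2 * (b%:R^-1 * A) * mxdot u (x i - mu k)).
  move=> /eqP ->; rewrite bform_outer.
  have -> : x i - class_mean y x k = (x i - mu k) - (class_mean y x k - mu k).
    by rewrite opprB addrA subrK.
  rewrite mxdotBr class_mean_subE mxdotZr mxdot_sumr -/A; ring.
rewrite (eq_bigr _ e) big_split/=; congr (_ + _).
rewrite sumrB sumr_const balanced_card -[X in _ - X]mulr_sumr -/A.
by rewrite -[(_ ^+ 2) *+ b]mulr_natr; field.
Qed.

Lemma grand_meanE : grand_mean x = \sum_k K%:R^-1 *: class_mean y x k.
Proof.
rewrite /grand_mean (partition_big y predT)//= natrM invfM scaler_sumr.
by apply: eq_bigr => k _; rewrite scalerA.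
Qed.

End Pooled_identities.

(** * Laws of the samples and deviations of the averaged statistics *)

Section Transfer.
Context dT (T : measurableType dT) (R : realType) (P : probability T R).
Context dT' (T' : measurableType dT') (X : {RV P >-> T'}) (Q : probability T' R).
Hypothesis XQ : has_law X Q.

Lemma ge0_expectation_law (h : T' -> R) : measurable_fun setT h ->
  (forall x, 0 <= h x) -> ('E_P[h \o X] = 'E_Q[h])%E.
Proof.
move=> mh h0; rewrite unlock.
transitivity (\int[distribution P X]_x (h x)%:E)%E.
  rewrite ge0_integral_distribution//; exact/measurable_EFinP.
by apply: eq_measure_integral => A mA _; exact: XQ.
Qed.

Lemma Lfun1_law (h : T' -> R) : h \in Lfun Q 1 ->
  h \o X \in Lfun P 1 /\ ('E_P[h \o X] = 'E_Q[h])%E.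
Proof.
move=> /Lfun1_integrable hQ.
have mh : measurable_fun setT h by apply/measurable_EFinP; case/integrableP: hQ.
have hX : P.-integrable setT (EFin \o (h \o X)).
  apply/integrableP; split.
    by apply/measurable_EFinP; exact: measurableT_comp.
  have := ge0_expectation_law (h := fun x => `|h x|); rewrite unlock /= => -> //.
    by case/integrableP: hQ.
  exact: measurableT_comp.
split; first exact/Lfun1_integrable.
rewrite unlock -(@integral_distribution _ _ _ _ _ _ X (EFin \o h))//.
  by apply: eq_measure_integral => A mA _; exact: XQ.
exact/measurable_EFinP.
Qed.

End Transfer.

Section Model.
Context (R : realType) (sigma2 : R) (sigma2_gt0 : 0 < sigma2).
Context (K M d b : nat) (b_ge2 : (2 <= b)%N).
Context (Q : 'I_K -> probability (d.-tuple R) R).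
Variables (mu : 'I_K -> 'cV[R]_d) (Sigma : 'M[R]_d).
Hypothesis Sigma_unit : Sigma \in unitmx.
Hypothesis Q_moments : forall k, has_mean_cov (Q k) (mu k) Sigma.
Hypothesis Q_sub_gaussian : forall k, sub_gaussian sigma2 (Q k) (mu k) Sigma.
Context (dOm : measure_display) (Om : measurableType dOm) (P : probability Om R).
Variable y : 'I_M -> 'I_(K * b) -> 'I_K.
Hypothesis y_bal : forall m, balanced_labels (y m).
Variable X : 'I_M * 'I_(K * b) -> {RV P >-> d.-tuple R}.
Hypothesis X_indep : mutually_independent X.
Hypothesis X_law : forall m i, has_law (X (m, i)) (Q (y m i)).

Local Notation pt := ('I_M * 'I_(K * b))%type.
Implicit Types (u : 'cV[R]_d) (p : pt) (g : 'I_M * 'I_K) (w : Om).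

Let b_gt0 : (0 < b)%N. Proof. exact: leq_trans b_ge2. Qed.
Let q u := bform Sigma u u.

Definition noise u p w : R := mxdot u (col_of_tuple (X p w) - mu (y p.1 p.2)).

Let law p : has_law (X p) (Q (y p.1 p.2)).
Proof. by case: p => m i; exact: X_law. Qed.

Lemma noise_adapted u p : adapted X [set p]%SET (noise u p).
Proof.
have mh := measurable_proj_centered (mu (y p.1 p.2)) u.
have pp : p \in [set p]%SET by rewrite inE.
exact: (@adapted_comp _ _ _ _ _ _ _ X p [set p]%SET _ pp mh).
Qed.

Lemma noise_measurable u p : measurable_fun setT (noise u p).
Proof. exact: adapted_measurable (@noise_adapted u p). Qed.

Lemma noise_subgaussian u p : subgaussian P (noise u p) (sigma2 * q u).
Proof.
split; first exact: noise_measurable.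
move=> l.
have [_ /(_ l) sQ] := sub_gaussian_proj Sigma_unit (Q_sub_gaussian (y p.1 p.2)) u.
apply: le_trans sQ; rewrite -(ge0_expectation_law (@law p))//.
by apply: measurable_expR_lin; exact: measurable_proj_centered.
Qed.

Lemma noise_sqr u p : ('E_P[fun w => (noise u p w ^+ 2)%R] = (q u)%:E)%E.
Proof.
rewrite -(expectation_proj_centered_sqr (Q_moments (y p.1 p.2))).
rewrite -(ge0_expectation_law (@law p))//; last by move=> x; exact: sqr_ge0.
by apply: measurable_funX; exact: measurable_proj_centered.
Qed.

Lemma noise_Lfun1 u p : noise u p \in Lfun P 1 /\ ('E_P[noise u p] = 0)%E.
Proof.
have [L E] := proj_centered_Lfun1 (Q_moments (y p.1 p.2)) u.
by have [LP EP] := Lfun1_law (@law p) L; split => //; rewrite -E -EP.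
Qed.

Definition cell g : {set pt} := [set p | (p.1 == g.1) && (y p.1 p.2 == g.2)]%SET.

Lemma sum_cell g (F : pt -> R) :
  \sum_(p in cell g) F p = \sum_(i | y g.1 i == g.2) F (g.1, i).
Proof.
transitivity (\sum_(m | m == g.1) \sum_(i | y m i == g.2) F (m, i)).
  rewrite pair_big_dep; apply: eq_big => [p|[m i] _ //]; by rewrite inE.
by rewrite big_pred1_eq.
Qed.

Lemma card_cell g : #|cell g| = b.
Proof.
apply: etrans (balanced_card (@y_bal g.1) g.2); rewrite -!sum1_card.
transitivity (\sum_(m | m == g.1) \sum_(i | y m i == g.2) 1)%N.
  by rewrite pair_big_dep; apply: eq_bigl => p; rewrite inE.
by rewrite big_pred1_eq.
Qed.

Lemma disjoint_cell g h : g != h -> [disjoint cell g & cell h]%B.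
Proof.
move=> gh; apply/pred0Pn => -[p /andP[/=]]; rewrite !inE.
move=> /andP[/eqP p1 /eqP p2] /andP[/eqP q1 /eqP q2].
by case/eqP: gh; case: g h p1 p2 q1 q2 => ? ? [? ?] /= <- <- <- <-.
Qed.

Lemma disjoint_singleton (A : {pred pt}) p p' : p \in A -> p' \in A -> p != p' ->
  [disjoint [set p]%SET & [set p']%SET]%B.
Proof.
move=> _ _ pp'; apply/pred0Pn => -[r /andP[/=]]; rewrite !inE => /eqP -> /eqP e.
by move: pp'; rewrite e eqxx.
Qed.

(** Division by [sqrt b] gives a class sum the second moment and the variance proxy of a single
    noise, so both parts of the scatter fall under the same tail bound. *)
Definition cell_noise u g w : R :=
  (Num.sqrt b%:R)^-1 * \sum_(p in cell g) noise u p w.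

Lemma cell_noise_adapted u g : adapted X (cell g) (cell_noise u g).
Proof.
rewrite /adapted /cell_noise; apply: measurable_funM => //.
under eq_fun do rewrite -big_enum.
apply: adapted_sum => p; rewrite mem_enum => pg.
by apply: adapted_sub (@noise_adapted u p); rewrite finset.sub1set.
Qed.

Let sqrtb2 : (Num.sqrt b%:R)^-1 ^+ 2 = b%:R^-1 :> R.
Proof. by rewrite exprVn sqr_sqrtr. Qed.

Let b_neq0 : b%:R != 0 :> R. Proof. by rewrite pnatr_eq0 -lt0n. Qed.

Lemma cell_noise_subgaussian u g : subgaussian P (cell_noise u g) (sigma2 * q u).
Proof.
have := @subgaussian_sum _ _ _ P _ _ _ X X_indep _ (mem (cell g)) (fun p => [set p]%SET)
  (@disjoint_singleton _) (noise u) (fun p _ => @noise_adapted u p)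
  (fun=> sigma2 * q u) (fun p _ => noise_subgaussian u p).
move=> /(subgaussian_scale (Num.sqrt b%:R)^-1).
by rewrite sqrtb2 sumr_const card_cell -[(sigma2 * q u) *+ b]mulr_natl mulKf.
Qed.

Lemma cell_noise_sqr u g : ('E_P[fun w => (cell_noise u g w ^+ 2)%R] = (q u)%:E)%E.
Proof.
under eq_fun do rewrite exprMn sqrtb2.
have mS : measurable_fun setT (fun w => \sum_(p in cell g) noise u p w).
  under eq_fun do rewrite -big_enum.
  by apply: measurable_sum => p; exact: noise_measurable.
rewrite ge0_expectationZl//; last 2 first.
- exact: measurable_funX.
- by move=> w; exact: sqr_ge0.
rewrite (@expectation_sqr_sum _ _ _ P _ _ _ X X_indep _ (mem (cell g)) (fun p => [set p]%SET)
  (@disjoint_singleton _) (noise u) (q u)).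
- by rewrite -EFinM card_cell mulKf.
- by move=> p _; exact: noise_adapted.
- by move=> p _; have [] := noise_Lfun1 u p.
- by move=> p _; have [] := noise_Lfun1 u p.
- by move=> p _; exact: noise_sqr.
Qed.

Lemma cell_noise_measurable u g : measurable_fun setT (cell_noise u g).
Proof. exact: adapted_measurable (@cell_noise_adapted u g). Qed.

(** An arbitrary set of machines covers both the full average and the first machine alone. *)
Definition pooled_avg (S : {set 'I_M}) w : 'M[R]_d :=
  #|S|%:R^-1 *: \sum_(m in S) pooled_cov (y m) (fun i => col_of_tuple (X (m, i) w)).

Lemma sum_setXT (I : finType) (S : {set 'I_M}) (F : 'I_M * I -> R) :
  \sum_(p in finset.setX S [set: I]%SET) F p = \sum_(m in S) \sum_i F (m, i).
Proof.
rewrite pair_big_dep; apply: eq_big => [[m i]|[m i] _ //].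
by rewrite !inE /= andbT.
Qed.

Lemma bform_pooled_avg (S : {set 'I_M}) u w :
  bform (pooled_avg S w) u u = (#|S|%:R * ((K * b)%:R - K%:R))^-1 *
    (\sum_(p in finset.setX S [set: 'I_(K * b)]%SET) noise u p w ^+ 2
     - \sum_(g in finset.setX S [set: 'I_K]%SET) cell_noise u g w ^+ 2).
Proof.
rewrite /pooled_avg bformZ bform_sum invfM -mulrA; congr (_ * _).
rewrite !sum_setXT -sumrB mulr_sumr; apply: eq_bigr => m _.
rewrite (bform_pooled_cov b_gt0 _ (@y_bal m) mu); congr (_ * (_ - _)).
apply: eq_bigr => k _; rewrite /cell_noise exprMn sqrtb2; congr (_ * _ ^+ 2).
by rewrite sum_cell; apply: eq_bigr => i /eqP <-.
Qed.

(** The sums of squares over samples and over cells are centered separately, and each deviates by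
    less than [t] times the sample size and the variance proxy. As [b >= 2], the normalization
    [K b - K] is at least half of [K b], so the two contributions add up to [4 * t]; two two-sided
    tails give the 4 in front of the exponential. *)
Lemma quad_tail (S : {set 'I_M}) (t : R) u : (0 < K)%N -> (0 < #|S|)%N -> 0 < t <= 1 ->
  measurable [set w | 4 * t * (sigma2 * q u) < `|bform (pooled_avg S w) u u - q u|] /\
  (P [set w | (4 * t * (sigma2 * q u) < `|bform (pooled_avg S w) u u - q u|)%R]
    <= (4 * expR (- ((t / 192) ^+ 2 * (#|S| * (K * b))%:R / 2)))%:E)%E.
Proof.
move=> K0 S0 t01; have /andP[t0 t1] := t01.
set As := finset.setX S [set: 'I_(K * b)]%SET; set Ag := finset.setX S [set: 'I_K]%SET.
set N := #|S|%:R * ((K * b)%:R - K%:R) : R.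
have K0' : 0 < K%:R :> R by rewrite ltr0n.
have S0' : 0 < #|S|%:R :> R by rewrite ltr0n.
have b2 : 2 <= b%:R :> R by rewrite ler_nat.
have NE : N = #|S|%:R * K%:R * (b%:R - 1) by rewrite /N natrM; ring.
have SK0 : 0 < #|S|%:R * K%:R :> R by exact: mulr_gt0.
have N0 : 0 < N by rewrite NE mulr_gt0// subr_gt0; lra.
have NsE : (#|S| * (K * b))%:R = #|S|%:R * K%:R * b%:R :> R by rewrite !natrM mulrA.
have N2 : (#|S| * (K * b))%:R <= 2 * N by rewrite NsE NE; nra.
have cAs : #|As|%:R = (#|S| * (K * b))%:R :> R by rewrite cardsX cardsT card_ord.
have cAg : #|Ag|%:R = #|S|%:R * K%:R :> R by rewrite cardsX cardsT card_ord natrM.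
have mD : measurable_fun setT (fun w => bform (pooled_avg S w) u u - q u).
  under eq_fun do rewrite bform_pooled_avg -!big_enum.
  apply: measurable_funB => //; apply: measurable_funM => //; apply: measurable_funB.
    by apply: measurable_sum => p; apply: measurable_funX; exact: noise_measurable.
  by apply: measurable_sum => g; apply: measurable_funX; exact: cell_noise_measurable.
have mE : measurable [set w | 4 * t * (sigma2 * q u) < `|bform (pooled_avg S w) u u - q u|].
  by apply: measurable_set_gt; exact: measurableT_comp.
split=> //.
(* The variance proxy vanishes at [u = 0]; there the strict inequality makes the event empty. *)
have [u0|u0] := eqVneq u 0.
  rewrite (_ : [set w | _] = set0) ?measure0 ?lee_fin ?mulr_ge0 ?expR_ge0//.
  rewrite -subset0 => w /=; rewrite /q u0 /bform !mulmx0 !mxE.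
  by rewrite subr0 normr0 !mulr0 ltxx.
have q0 : 0 < q u.
  by have := bform_gt0 Sigma_unit (Q_sub_gaussian (Ordinal K0)) u0.
set v := sigma2 * q u; have v0 : 0 < v by exact: mulr_gt0.
have PA : (P [set w | (t * (#|S| * (K * b))%:R * v <= `|\sum_(p in As) (noise u p w ^+ 2 - q u)|)%R]
    <= (2 * expR (- ((t / 192) ^+ 2 * (#|S| * (K * b))%:R / 2)))%:E)%E.
  apply: (@sum_sqr_tail _ _ _ P _ _ _ X X_indep _ (mem As) (fun p => [set p]%SET)) => //.
  - exact: disjoint_singleton.
  - by move=> p _; exact: noise_adapted.
  - by move=> p _; exact: noise_subgaussian.
  - by move=> p _; exact: noise_sqr.
  - by rewrite cAs.
have PB : (P [set w | (t * (#|S| * (K * b))%:R * v <= `|\sum_(g in Ag) (cell_noise u g w ^+ 2 - q u)|)%R]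
    <= (2 * expR (- ((t / 192) ^+ 2 * (#|S| * (K * b))%:R / 2)))%:E)%E.
  apply: (@sum_sqr_tail _ _ _ P _ _ _ X X_indep _ (mem Ag) cell) => //.
  - by move=> g h _ _; exact: disjoint_cell.
  - by move=> g _; exact: cell_noise_adapted.
  - by move=> g _; exact: cell_noise_subgaussian.
  - by move=> g _; exact: cell_noise_sqr.
  - by rewrite cAg NsE; nra.
set EA := [set w | _] in PA; set EB := [set w | _] in PB.
have mEA : measurable EA.
  apply: measurable_set_ge; apply: measurableT_comp => //.
  under eq_fun do rewrite -big_enum.
  apply: measurable_sum => p; apply: measurable_funB => //.
  by apply: measurable_funX; exact: noise_measurable.
have mEB : measurable EB.
  apply: measurable_set_ge; apply: measurableT_comp => //.
  under eq_fun do rewrite -big_enum.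
  apply: measurable_sum => p; apply: measurable_funB => //.
  by apply: measurable_funX; exact: cell_noise_measurable.
apply: (@le_trans _ _ (P (EA `|` EB))).
  apply: le_measure; rewrite ?inE//; first exact: measurableU.
  move=> w /= h; apply: contrapT => /not_orP[/negP]; rewrite /EA /EB /=.
  rewrite -ltNge => hA /negP; rewrite -ltNge => hB.
  move: h; apply/negP; rewrite -leNgt.
  (* The number of samples minus the number of cells is [N], so the centerings of the two sums
     recombine exactly to [q u]. *)
  have -> : bform (pooled_avg S w) u u - q u = N^-1 *
      (\sum_(p in As) (noise u p w ^+ 2 - q u)
       - \sum_(g in Ag) (cell_noise u g w ^+ 2 - q u)).
    rewrite bform_pooled_avg -/As -/Ag -/N !sumrB !sumr_const.
    rewrite -(mulr_natr (q u) #|As|) -(mulr_natr (q u) #|Ag|) cAs cAg NsE NE.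
    field; lra.
  rewrite normrM gtr0_norm ?invr_gt0// mulrC ler_pdivrMr//.
  apply: le_trans (ler_normB _ _) _.
  have tv : 0 <= t * v by rewrite mulr_ge0// ltW.
  have := ler_wpM2l tv N2; lra.
apply: le_trans (measureU2 _ _ _) _ => //.
apply: (le_trans (leeD PA PB)).
by rewrite -EFinD lee_fin; lra.
Qed.

Lemma bform_delta (S : 'M[R]_d) j l : bform S (delta_mx j 0) (delta_mx l 0) = S j l.
Proof.
by rewrite /bform trmx_delta -rowE -colE !mxE.
Qed.

Lemma mxdot_delta j (v : 'cV[R]_d) : mxdot (delta_mx j 0) v = v j 0.
Proof. by rewrite /mxdot trmx_delta -rowE /mxtrace big_ord1 mxE. Qed.

Definition mean_dev k j w : R := M%:R^-1 *
  \sum_m (class_mean (y m) (fun i => col_of_tuple (X (m, i) w)) k - mu k) j 0.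

Lemma mean_tail (r : R) k j : (0 < M)%N -> 0 <= r ->
  measurable [set w | r < `|mean_dev k j w|] /\
  (P [set w | (r < `|mean_dev k j w|)%R]
   <= (2 * expR (- (r ^+ 2 * (M * b)%:R / (2 * (sigma2 * Sigma j j)))))%:E)%E.
Proof.
move=> M0 r0.
pose u : 'cV[R]_d := delta_mx j 0.
have qE : q u = Sigma j j by rewrite /q bform_delta.
have u0 : u != 0.
  apply/eqP => /matrixP/(_ j 0); rewrite !mxE !eqxx /=.
  by move/eqP; rewrite oner_eq0.
have q0 : 0 < Sigma j j.
  by have := bform_gt0 Sigma_unit (Q_sub_gaussian k) u0; rewrite -/(q u) qE.
have M0' : 0 < M%:R :> R by rewrite ltr0n.
have b0' : 0 < b%:R :> R by rewrite ltr0n.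
pose B := [set p : pt | y p.1 p.2 == k]%SET.
have sumB (F : pt -> R) : \sum_(p in B) F p = \sum_m \sum_(i | y m i == k) F (m, i).
  rewrite pair_big_dep; apply: eq_big => [[m i]|[m i] _ //].
  by rewrite !inE.
have cB : #|B|%:R = M%:R * b%:R :> R.
  rewrite -sumr_const sumB; under eq_bigr do rewrite sumr_const.
  under eq_bigr => m _ do rewrite (balanced_card (@y_bal m) k).
  by rewrite sumr_const card_ord mulr_natl.
have devE w : mean_dev k j w = (M%:R * b%:R)^-1 * \sum_(p in B) noise u p w.
  rewrite /mean_dev sumB invfM -[RHS]mulrA; congr (_ * _).
  rewrite mulr_sumr; apply: eq_bigr => m _; rewrite (class_mean_subE b_gt0 _ (@y_bal m)).
  rewrite mxE summxE; congr (_ * _); apply: eq_bigr => i /eqP ymi.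
  by rewrite /noise mxdot_delta /= ymi.
have sub := @subgaussian_sum _ _ _ P _ _ _ X X_indep _ (mem B) (fun p => [set p]%SET)
  (@disjoint_singleton _) (noise u) (fun p _ => @noise_adapted u p)
  (fun=> sigma2 * q u) (fun p _ => noise_subgaussian u p).
have := subgaussian_scale (M%:R * b%:R)^-1 sub.
have -> : (fun x => (M%:R * b%:R)^-1 * \sum_(g in mem B) noise u g x) = mean_dev k j.
  by apply/funext => w; rewrite devE.
rewrite sumr_const -[(sigma2 * q u) *+ _]mulr_natl cB qE => sdev.
have v0 : 0 < (M%:R * b%:R)^-1 ^+ 2 * (M%:R * b%:R * (sigma2 * Sigma j j)).
  by rewrite mulr_gt0// ?exprn_gt0 ?invr_gt0 ?mulr_gt0.
have := subgaussian_tail v0 r0 sdev.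
have -> : r ^+ 2 / (2 * ((M%:R * b%:R)^-1 ^+ 2 * (M%:R * b%:R * (sigma2 * Sigma j j)))) =
    r ^+ 2 * (M * b)%:R / (2 * (sigma2 * Sigma j j)).
  by rewrite natrM; field; rewrite !lt0r_neq0.
have mdev : measurable_fun setT (mean_dev k j) by case: sdev.
have mE : measurable [set w | r < `|mean_dev k j w|].
  by apply: measurable_set_gt; exact: measurableT_comp.
move=> h; split=> //; apply: le_trans h; apply: le_measure; rewrite ?inE//.
  by apply: measurable_set_ge; exact: measurableT_comp.
by move=> w /= /ltW.
Qed.

End Model.

(** * Restricted eigenvalues of the sample covariance *)

Section Maurey.
Context (R : realType) (d : nat).
Implicit Types (B : 'M[R]_d) (u v w zeta : 'cV[R]_d).

Lemma bformDl B u v w : bform B (u + v) w = bform B u w + bform B v w.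
Proof. by rewrite /bform linearD/= !mulmxDl mxE. Qed.

Lemma bformDr B u v w : bform B w (u + v) = bform B w u + bform B w v.
Proof. by rewrite /bform mulmxDr mxE. Qed.

Lemma bformZl (c : R) B u v : bform B (c *: u) v = c * bform B u v.
Proof. by rewrite /bform linearZ/= -!scalemxAl mxE. Qed.

Lemma bformZr (c : R) B u v : bform B u (c *: v) = c * bform B u v.
Proof. by rewrite /bform -scalemxAr mxE. Qed.

Lemma bform_suml (I : Type) (r : seq I) (F : I -> 'cV[R]_d) B v :
  bform B (\sum_(i <- r) F i) v = \sum_(i <- r) bform B (F i) v.
Proof. by rewrite /bform raddf_sum/= !mulmx_suml summxE. Qed.

Lemma bform_sumr (I : Type) (r : seq I) (F : I -> 'cV[R]_d) B v :
  bform B v (\sum_(i <- r) F i) = \sum_(i <- r) bform B v (F i).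
Proof. by rewrite /bform mulmx_sumr summxE. Qed.

Definition signed_unit (a : 'I_d * bool) : 'cV[R]_d := (-1) ^+ a.2 *: delta_mx a.1 0.

(* Lists of a given length have finitely many walks, whence no net is needed to
   control a quadratic form on all of them. *)
Definition walk (s : seq ('I_d * bool)) : 'cV[R]_d := \sum_(a <- s) signed_unit a.

Lemma bform_signed_unit B a : bform B (signed_unit a) (signed_unit a) = B a.1 a.1.
Proof. by rewrite bformZl bformZr mulrA -expr2 sqrr_sign mul1r bform_delta. Qed.

(* The right-hand side is the mean of [bform B z z] over the random walk [z]
   of length [k] from [v] whose steps have mean [zeta]. *)
Lemma walk_mean_ge0 B zeta (k : nat) v : \sum_j `|zeta j 0| = 1 ->
  (forall s, size s = k -> 0 <= bform B (v + walk s) (v + walk s)) ->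
  0 <= bform B v v + k%:R * (bform B v zeta + bform B zeta v)
       + k%:R * (k%:R - 1) * bform B zeta zeta
       + k%:R * \sum_j `|zeta j 0| * B j j.
Proof.
move=> z1; elim: k v => [|k IH] v Bs.
  have := Bs [::] erefl; rewrite /walk big_nil addr0 => h.
  by rewrite !mul0r !addr0.
(* One step of the walk: direction [j] with probability [|zeta_j|], signed like [zeta_j], so that
   its mean is [zeta] by [zE]. Averaging [step] over [j] is conditioning on the first step. *)
pose e j := signed_unit (j, zeta j 0 < 0).
have zE : zeta = \sum_j `|zeta j 0| *: e j.
  rewrite [LHS]matrix_sum_delta; apply: eq_bigr => j _.
  by rewrite big_ord1 scalerA mulrC -numEsign.
set D := \sum_j `|zeta j 0| * B j j.
have step j : 0 <= bform B (v + e j) (v + e j)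
    + k%:R * (bform B (v + e j) zeta + bform B zeta (v + e j))
    + k%:R * (k%:R - 1) * bform B zeta zeta + k%:R * D.
  apply: IH => s sk; have := Bs ((j, zeta j 0 < 0) :: s).
  by rewrite /= sk /walk big_cons addrA; exact.
have avg (h : 'I_d -> R) : (forall j, 0 <= h j) -> 0 <= \sum_j `|zeta j 0| * h j.
  by move=> h0; apply: sumr_ge0 => j _; rewrite mulr_ge0.
have := avg _ step.
have Ec (c : R) : \sum_j `|zeta j 0| * c = c by rewrite -mulr_suml z1 mul1r.
have El w : \sum_j `|zeta j 0| * bform B (e j) w = bform B zeta w.
  transitivity (bform B (\sum_j `|zeta j 0| *: e j) w); last by rewrite -zE.
  by rewrite bform_suml; apply: eq_bigr => j _; rewrite [RHS]bformZl.
have Er w : \sum_j `|zeta j 0| * bform B w (e j) = bform B w zeta.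
  transitivity (bform B w (\sum_j `|zeta j 0| *: e j)); last by rewrite -zE.
  by rewrite bform_sumr; apply: eq_bigr => j _; rewrite [RHS]bformZr.
have avgD (f g : 'I_d -> R) : \sum_j `|zeta j 0| * (f j + g j) =
    \sum_j `|zeta j 0| * f j + \sum_j `|zeta j 0| * g j.
  by rewrite -big_split; apply: eq_bigr => j _; rewrite mulrDr.
have avgZ c (f : 'I_d -> R) : \sum_j `|zeta j 0| * (c * f j) =
    c * \sum_j `|zeta j 0| * f j.
  by rewrite mulr_sumr; apply: eq_bigr => j _; rewrite mulrCA.
set C := bform B v v + k%:R * (bform B v zeta + bform B zeta v)
  + k%:R * (k%:R - 1) * bform B zeta zeta + k%:R * D.
have -> : \sum_j `|zeta j 0| * (bform B (v + e j) (v + e j) +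
      k%:R * (bform B (v + e j) zeta + bform B zeta (v + e j)) +
      k%:R * (k%:R - 1) * bform B zeta zeta + k%:R * D) =
    \sum_j `|zeta j 0| * (C + (bform B (e j) v + (bform B v (e j) + (B j j +
      (k%:R * bform B (e j) zeta + k%:R * bform B zeta (e j)))))).
  apply: eq_bigr => j _; congr (_ * _).
  rewrite !(bformDl, bformDr) bform_signed_unit/= /C; ring.
rewrite avgD (Ec C) !avgD !avgZ !El !Er -/D => h.
apply: le_trans h _; rewrite le_eqVlt; apply/orP; left; apply/eqP.
by rewrite -natr1 /C; ring.
Qed.

Lemma maurey B zeta (k : nat) (D : R) :
  (forall s : k.+1.-tuple ('I_d * bool), 0 <= bform B (walk s) (walk s)) ->
  (forall j, B j j <= D) ->
  - (D * (\sum_j `|zeta j 0|) ^+ 2) <= k%:R * bform B zeta zeta.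
Proof.
move=> Bs BD; set L := \sum_j `|zeta j 0|.
have L0 : 0 <= L by apply: sumr_ge0.
have [L0'|Lpos] := eqVneq L 0.
  have -> : zeta = 0.
    apply/matrixP => i j; rewrite ord1 mxE; apply/eqP; rewrite -normr_eq0.
    by move/eqP: L0'; rewrite psumr_eq0// => /allP/(_ i (mem_index_enum _)).
  by rewrite L0' expr0n mulr0 oppr0 /bform mulmx0 mxE mulr0.
have Lgt0 : 0 < L by rewrite lt_neqAle eq_sym Lpos.
pose z := L^-1 *: zeta.
have z1 : \sum_j `|z j 0| = 1.
  under eq_bigr do rewrite mxE normrM gtr0_norm ?invr_gt0//.
  by rewrite -mulr_sumr mulVf.
(* From the origin, [k + 1] steps have [(k + 1) k] ordered pairs of distinct steps, each with mean
   [bform B z z], and [k + 1] diagonal terms; division by [k + 1] leaves the factor [k]. *)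
have := @walk_mean_ge0 B z k.+1 0 z1.
have -> : bform B 0 z = 0 by rewrite /bform trmx0 !mul0mx mxE.
have -> : bform B z 0 = 0 by rewrite /bform mulmx0 mxE.
have -> : bform B 0 0 = 0 by rewrite /bform mulmx0 mxE.
rewrite !addr0 !add0r mulr0 add0r => h.
have {}h := h (fun s sk => ltac:(rewrite add0r; exact: (Bs (Tuple (introT eqP sk))))).
have Dz : \sum_j `|z j 0| * B j j <= D.
  rewrite -[leRHS]mul1r -z1 mulr_suml; apply: ler_sum => j _.
  exact: ler_wpM2l.
have k0 : 0 < k.+1%:R :> R by rewrite ltr0n.
have zz : bform B zeta zeta = L ^+ 2 * bform B z z.
  by rewrite bformZl bformZr; field.
have h2 : 0 <= k%:R * bform B z z + D.
  rewrite -(pmulr_rge0 _ k0); apply: le_trans h _.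
  rewrite (_ : k.+1%:R - 1 = k%:R :> R); last by rewrite -natr1; ring.
  by rewrite -mulrA -mulrDr ler_wpM2l ?(ltW k0)// lerD2l.
rewrite zz; have := mulr_ge0 (sqr_ge0 L) h2; lra.
Qed.

End Maurey.

Section Restricted_eigenvalue.
Context (R : realType) (d : nat).

Lemma sqr_sum_le_card (I : finType) (A : {set I}) (a : I -> R) :
  (\sum_(i in A) a i) ^+ 2 <= #|A|%:R * \sum_(i in A) a i ^+ 2.
Proof.
have [A0|A0] := posnP #|A|.
  by rewrite A0 mul0r big_pred0 ?expr0n// => i; have /card0_eq -> := A0.
have A0' : 0 < #|A|%:R :> R by rewrite ltr0n.
set S := \sum_(i in A) a i; set c := #|A|%:R : R; set q := \sum_(i in A) _.
have : 0 <= \sum_(i in A) (c * a i - S) ^+ 2 by apply: sumr_ge0 => i _; exact: sqr_ge0.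
have -> : \sum_(i in A) (c * a i - S) ^+ 2 = c * (c * q - S ^+ 2).
  under eq_bigr do rewrite sqrrB exprMn.
  rewrite big_split/= sumrB -mulr_sumr sumr_const -/q.
  rewrite -[(S ^+ 2) *+ _]mulr_natr -/c.
  have -> : \sum_(i in A) c * a i * S *+ 2 = 2 * c * S * S.
    by rewrite {2}/S mulr_sumr; apply: eq_bigr => i _; rewrite -/S; ring.
  ring.
by rewrite pmulr_rge0// subr_ge0.
Qed.

Lemma vnorm1_split (A : {set 'I_d}) (z : 'cV[R]_d) :
  vnorm 1 (fun j => z j 0) = \sum_(j in A) `|z j 0| + \sum_(j in ~: A) `|z j 0|.
Proof.
rewrite vnorm1E (bigID (mem A))/=; congr (_ + _).
by apply: eq_bigl => j; rewrite inE.
Qed.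

Lemma in_coneE (A : {set 'I_d}) (z : 'cV[R]_d) : in_cone A z <->
  \sum_(j in ~: A) `|z j 0| <= 3 * \sum_(j in A) `|z j 0|.
Proof.
rewrite /in_cone !vnorm1E.
have -> : \sum_i `|if i \in A then 0 else z i 0| = \sum_(j in ~: A) `|z j 0|.
  rewrite [RHS]big_mkcond; apply: eq_bigr => j _; rewrite inE.
  by case: ifP; rewrite ?normr0.
have -> // : \sum_i `|if i \in A then z i 0 else 0| = \sum_(j in A) `|z j 0|.
rewrite [RHS]big_mkcond; apply: eq_bigr => j _.
by case: ifP; rewrite ?normr0.
Qed.

Lemma vnorm2_sqr (z : 'cV[R]_d) : vnorm 2 (fun j => z j 0) ^+ 2 = \sum_j z j 0 ^+ 2.
Proof. by rewrite vnorm2E sqr_sqrtr// sumr_ge0// => j _; exact: sqr_ge0. Qed.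

Lemma sum_abs_sqr_le (A : {set 'I_d}) (z : 'cV[R]_d) :
  (\sum_(j in A) `|z j 0|) ^+ 2 <= #|A|%:R * \sum_j z j 0 ^+ 2.
Proof.
apply: le_trans (sqr_sum_le_card _ _) _; rewrite ler_wpM2l//.
rewrite [leRHS](bigID (mem A))/= -[leLHS]addr0 lerD//.
  by apply: ler_sum => j _; rewrite real_normK ?num_real.
by apply: sumr_ge0 => j _; exact: sqr_ge0.
Qed.

(** Maurey's bound is applied to [Shat - S / 2] with [k0 * s] in the role of [k]. On the cone the
    squared l1 norm is at most [16 s] times the squared l2 norm, so the loss is at most
    [16 c / k0 <= kappa / 3], and [kappa / 2 - kappa / 3] exceeds [kappa / 8]. *)
Lemma restricted_eigenvalue_sample (S Shat : 'M[R]_d) (kappa c : R) (s k0 : nat) :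
  0 < kappa -> 48 * c <= kappa * k0%:R -> (0 < s)%N -> 0 < c ->
  (forall j, S j j <= c) ->
  restricted_eigenvalue kappa s S ->
  (forall t : (k0 * s).+1.-tuple ('I_d * bool),
     `|bform Shat (walk R t) (walk R t) - bform S (walk R t) (walk R t)|
       <= 2^-1 * bform S (walk R t) (walk R t)) ->
  forall (A : {set 'I_d}) (z : 'cV[R]_d), (#|A| <= s)%N -> in_cone A z ->
    kappa / 8 * \sum_j z j 0 ^+ 2 <= bform Shat z z.
Proof.
move=> kappa0 kc s0 c0 Sc RE dev A z As zA.
pose B := Shat - 2^-1 *: S.
have BE u v : bform B u v = bform Shat u v - 2^-1 * bform S u v.
  by rewrite /B -scaleNr bformD bformZ mulNr.
have Bwalk (t : (k0 * s).+1.-tuple ('I_d * bool)) : 0 <= bform B (walk R t) (walk R t).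
  by have := dev t; rewrite BE ler_norml => /andP[]; lra.
have Bdiag j : B j j <= c.
  (* The walk that repeats one unit vector yields [Shat j j <= 3 / 2 * S j j]. *)
  have := dev [tuple of nseq (k0 * s).+1 (j, false)].
  have -> : walk R [tuple of nseq (k0 * s).+1 (j, false)] =
      (k0 * s).+1%:R *: delta_mx j 0 :> 'cV[R]_d.
    rewrite /walk big_nseq iter_addr addr0 /signed_unit expr0 scale1r.
    by rewrite scaler_nat.
  rewrite !(bformZl, bformZr) !bform_delta.
  set m := (k0 * s).+1%:R; have m0 : 0 < m :> R by rewrite ltr0n.
  rewrite -!mulrBr [2^-1 * _]mulrCA [2^-1 * (m * _)]mulrCA.
  rewrite normrM gtr0_norm// ler_pM2l// normrM gtr0_norm// ler_pM2l//.
  rewrite ler_norml => /andP[_]; have := Sc j; rewrite !mxE; lra.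
have := maurey z Bwalk Bdiag; rewrite BE natrM.
have /in_coneE zA' := zA.
have := RE A z As zA; rewrite vnorm2_sqr -/(bform S z z).
have := sum_abs_sqr_le A z; set q := \sum_j z j 0 ^+ 2.
have := vnorm1_split A z; rewrite vnorm1E => ->.
set a := \sum_(j in A) _ in zA' *; set a' := \sum_(j in ~: A) _ in zA' *.
have a0 : 0 <= a by exact: sumr_ge0.
have a'0 : 0 <= a' by exact: sumr_ge0.
have q0 : 0 <= q by apply: sumr_ge0 => j _; exact: sqr_ge0.
have As' : #|A|%:R <= s%:R :> R by rewrite ler_nat.
have s0' : 0 < s%:R :> R by rewrite ltr0n.
move=> aq RE' mau.
have aa : (a + a') ^+ 2 <= 16 * (s%:R * q).
  have : (a + a') ^+ 2 <= (4 * a) ^+ 2 by apply: lerXn2r; rewrite ?nnegrE; lra.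
  have := ler_wpM2r q0 As'; rewrite exprMn; lra.
have k0_gt0 : 0 < k0%:R :> R by rewrite -(pmulr_rgt0 _ kappa0); lra.
have k0s : 0 < k0%:R * s%:R :> R by exact: mulr_gt0.
rewrite -(ler_pM2l k0s).
have h1 := ler_wpM2l (ltW c0) aa.
have h2 : 48 * c * (s%:R * q) <= kappa * k0%:R * (s%:R * q).
  by rewrite ler_wpM2r// mulr_ge0// ltW.
have h3 := ler_wpM2l (ltW k0s) RE'.
have e : k0%:R * s%:R * (kappa / 8 * q) = kappa * k0%:R * (s%:R * q) / 8 by field.
have e3 : k0%:R * s%:R * (kappa * q) = kappa * k0%:R * (s%:R * q) by ring.
rewrite e3 in h3; rewrite e.
have h4 : 0 <= kappa * k0%:R * (s%:R * q).
  by rewrite !mulr_ge0// ltW.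
rewrite mulrBr in mau; lra.
Qed.

End Restricted_eigenvalue.

(** * The penalized problems *)

Section Lasso_column.
Context (R : realType) (d : nat).
Variables (S : 'M[R]_d) (c wstar delta : 'cV[R]_d) (lam kappa : R).
Hypotheses (S_sym : S^T = S) (S_psd : forall v, 0 <= bform S v v).
Hypotheses (lam_gt0 : 0 < lam) (kappa_gt0 : 0 < kappa).

Definition lasso (w : 'cV[R]_d) : R :=
  2^-1 * bform S w w - mxdot w c + lam * \sum_j `|w j 0|.

Definition vsupp (w : 'cV[R]_d) : {set 'I_d} := [set j | w j 0 != 0]%SET.

Let A := vsupp wstar.

Hypothesis lasso_le : lasso (wstar + delta) <= lasso wstar.
Hypothesis residual : forall j, `|(S *m wstar - c) j 0| <= lam / 2.
Hypothesis curvature : forall z : 'cV[R]_d, in_cone A z ->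
  kappa * \sum_j z j 0 ^+ 2 <= bform S z z.

Lemma bform_sym (u v : 'cV[R]_d) : bform S u v = bform S v u.
Proof.
rewrite /bform -[in LHS]S_sym -trmx_mul -[in LHS](trmxK v) -trmx_mul mxE.
by rewrite mulmxA.
Qed.

Lemma lasso_basic_inequality :
  2^-1 * bform S delta delta + 2^-1 * lam * \sum_(j in ~: A) `|delta j 0|
  <= 3 / 2 * lam * \sum_(j in A) `|delta j 0|.
Proof.
have h1 : - (lam / 2 * \sum_j `|delta j 0|) <= mxdot delta (S *m wstar - c).
  rewrite mxdotE mulr_sumr -sumrN; apply: ler_sum => j _.
  rewrite -lerN2 opprK; apply: le_trans (ler_norm _) _.
  by rewrite normrN normrM mulrC ler_wpM2r.
have h2 : \sum_j `|wstar j 0| + \sum_(j in ~: A) `|delta j 0|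
    - \sum_(j in A) `|delta j 0| <= \sum_j `|(wstar + delta) j 0|.
  rewrite (bigID (mem A))/= [X in _ <= X](bigID (mem A))/=.
  rewrite [X in _ + X + _ - _]big1 ?addr0; last first.
    by move=> j; rewrite inE negbK => /eqP ->; rewrite normr0.
  rewrite addrAC lerD//.
    rewrite -sumrB; apply: ler_sum => j _.
    by rewrite [X in _ <= `|X|]mxE lerB_normD.
  rewrite le_eqVlt; apply/orP; left; apply/eqP.
  apply: eq_big => [j|j]; first by rewrite !inE.
  by rewrite !inE negbK => /eqP wj; rewrite [X in _ = `|X|]mxE wj add0r.
have h3 : bform S delta wstar = mxdot delta (S *m wstar).
  by rewrite /bform /mxdot -mulmxA /mxtrace big_ord1.
move: lasso_le; rewrite /lasso !(bformDl, bformDr) (bform_sym wstar delta) h3.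
have -> : mxdot (wstar + delta) c = mxdot wstar c + mxdot delta c.
  by rewrite mxdotC mxdotDr !(mxdotC c).
rewrite mxdotBr in h1.
have h4 := ler_wpM2l (ltW lam_gt0) h2.
have := vnorm1_split A delta; rewrite vnorm1E => e; rewrite e in h1.
rewrite mulrBr mulrDr in h4; move=> main.
lra.
Qed.

(** Let [a] be the l1 norm of the error on the support, [q] its squared l2 norm and [n] the size of
    the support. Curvature on the cone gives [kappa q <= 3 lam a] and Cauchy-Schwarz gives
    [a ^ 2 <= n q], whence [a <= 3 lam n / kappa]; the l1 norm is at most [4 a]. Both bounds are
    linear in [n], so they add up over the columns to the size of the full support. *)
Lemma lasso_column_bound :
  \sum_j `|delta j 0| <= 12 * lam / kappa * #|A|%:R /\
  \sum_j delta j 0 ^+ 2 <= (3 * lam / kappa) ^+ 2 * #|A|%:R.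
Proof.
have := lasso_basic_inequality.
have := vnorm1_split A delta; rewrite vnorm1E => ->.
have := S_psd delta.
have := @curvature delta; rewrite in_coneE.
have := sum_abs_sqr_le A delta.
set a := \sum_(j in A) _; set a' := \sum_(j in ~: A) _; set q := \sum_j _.
set n := #|A|%:R.
have a0 : 0 <= a by exact: sumr_ge0.
have a'0 : 0 <= a' by exact: sumr_ge0.
have n0 : 0 <= n by [].
move=> aq curv psd basic.
have cone : a' <= 3 * a.
  rewrite -(ler_pM2l lam_gt0); lra.
have {}curv := curv cone.
have la' : 0 <= lam * a' by rewrite mulr_ge0// ltW.
have h1 : kappa * q <= 3 * lam * a by lra.
have h2 : a <= 3 * lam / kappa * n.
  have [->|a_neq0] := eqVneq a 0.
    by rewrite !mulr_ge0 ?invr_ge0// ltW.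
  have apos : 0 < a by rewrite lt_neqAle eq_sym a_neq0.
  rewrite -(ler_pM2r apos) -(ler_pM2l kappa_gt0).
  have := ler_wpM2l (ltW kappa_gt0) aq.
  have := ler_wpM2l n0 h1.
  have -> : kappa * (3 * lam / kappa * n * a) = 3 * lam * n * a by field; rewrite lt0r_neq0.
  rewrite -expr2; lra.
split; first by apply: (@le_trans _ _ (4 * a)); lra.
rewrite -(ler_pM2l kappa_gt0); apply: le_trans h1 _.
have := ler_wpM2l (ltW (mulr_gt0 (ltr0n _ 3) lam_gt0) : 0 <= 3 * lam) h2.
move=> /le_trans; apply; rewrite le_eqVlt; apply/orP; left; apply/eqP.
by field; rewrite lt0r_neq0.
Qed.

End Lasso_column.

Section Matrix_lasso.
Context (R : realType) (d p : nat).
Implicit Types (S : 'M[R]_d) (U V W G : 'M[R]_(d, p)).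

Lemma mxdot_cols (V W : 'M[R]_(d, p)) : mxdot V W = \sum_k mxdot (col k V) (col k W).
Proof.
rewrite /mxdot /mxtrace; apply: eq_bigr => k _; rewrite mxE.
rewrite -/(\tr _) -/(mxdot (col k V) (col k W)) mxdotE.
by apply: eq_bigr => j _; rewrite !mxE.
Qed.

Lemma mxnorm11_cols (W : 'M[R]_(d, p)) : mxnorm 1 1 W = \sum_k \sum_j `|col k W j 0|.
Proof.
rewrite mxnorm11E exchange_big; apply: eq_bigr => k _.
by apply: eq_bigr => j _; rewrite mxE.
Qed.

Lemma col_mulmx S W k : col k (S *m W) = S *m col k W.
Proof. by rewrite !colE mulmxA. Qed.

(** The gradient correction [G] merges with the linear term [U], which makes every column an
    ordinary lasso problem. *)
Lemma penalized_loss_cols S U G W (lam : R) :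
  lda_loss S U W + mxdot G W + lam * mxnorm 1 1 W =
  \sum_k lasso S (col k (U - G)) lam (col k W).
Proof.
rewrite /lda_loss mxnorm11_cols !mxdot_cols !mulr_sumr -sumrB -!big_split/=.
apply: eq_bigr => k _; rewrite /lasso.
have -> : mxdot (col k W) (col k (S *m W)) = bform S (col k W) (col k W).
  by rewrite /bform col_mulmx -mulmxA /mxdot /mxtrace big_ord1.
by rewrite linearB/= mxdotBr (mxdotC (col k G)); ring.
Qed.

(* A matrix in the l1 cone of [mxsupp Wstar] may have columns outside all cones
   of vectors; only the separation of the objective puts every column of the
   error in the cone of its own support. *)
Lemma argmin_columnwise S U G What (lam : R) :
  is_argmin (fun W => lda_loss S U W + mxdot G W + lam * mxnorm 1 1 W) What ->
  forall k (w : 'cV[R]_d),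
    lasso S (col k (U - G)) lam (col k What) <= lasso S (col k (U - G)) lam w.
Proof.
move=> min k w.
pose W' : 'M[R]_(d, p) := \matrix_(j, l) if l == k then w j 0 else What j l.
have W'k : col k W' = w by apply/matrixP => i j; rewrite ord1 !mxE eqxx.
have W'l l : l != k -> col l W' = col l What.
  by move=> lk; apply/matrixP => i j; rewrite !mxE (negPf lk).
have := min W'; rewrite !penalized_loss_cols (bigD1 k)//= [leRHS](bigD1 k)//= W'k.
have -> : \sum_(i | i != k) lasso S (col i (U - G)) lam (col i W') =
          \sum_(i | i != k) lasso S (col i (U - G)) lam (col i What).
  by apply: eq_bigr => l lk; rewrite W'l.
by rewrite lerD2r.
Qed.

Lemma card_mxsupp_cols W : #|mxsupp W|%:R = \sum_k #|vsupp (col k W)|%:R :> R.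
Proof.
rewrite -natr_sum; congr _%:R.
under eq_bigr => k _ do rewrite -sum1_card big_mkcond.
rewrite exchange_big pair_big -sum1_card big_mkcond.
by apply: eq_bigr => -[j k] _; rewrite !inE mxE.
Qed.

Lemma lasso_matrix_bound S U G Wstar What (lam kappa : R) :
  S^T = S -> (forall v, 0 <= bform S v v) -> 0 < lam -> 0 < kappa ->
  is_argmin (fun W => lda_loss S U W + mxdot G W + lam * mxnorm 1 1 W) What ->
  (forall j k, `|(S *m Wstar - (U - G)) j k| <= lam / 2) ->
  (forall (A : {set 'I_d}) (z : 'cV[R]_d), (#|A| <= #|mxsupp Wstar|)%N ->
     in_cone A z -> kappa * \sum_j z j 0 ^+ 2 <= bform S z z) ->
  mxnorm 1 1 (What - Wstar) <= 12 * lam / kappa * #|mxsupp Wstar|%:R /\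
  mxnorm 2 2 (What - Wstar) <= 3 * lam / kappa * Num.sqrt #|mxsupp Wstar|%:R.
Proof.
move=> S_sym S_psd lam0 kappa0 min res RE.
have colD k : col k (What - Wstar) = col k What - col k Wstar by exact: linearB.
have bnd k := @lasso_column_bound R d S (col k (U - G)) (col k Wstar)
  (col k (What - Wstar)) lam kappa S_sym S_psd lam0 kappa0.
have {}bnd k : \sum_j `|col k (What - Wstar) j 0| <= 12 * lam / kappa * #|vsupp (col k Wstar)|%:R /\
    \sum_j col k (What - Wstar) j 0 ^+ 2 <= (3 * lam / kappa) ^+ 2 * #|vsupp (col k Wstar)|%:R.
  apply: bnd.
  - have -> : col k Wstar + col k (What - Wstar) = col k What.
      by rewrite colD addrC subrK.
    exact: argmin_columnwise.
  - move=> j; have := res j k; congr (`|_| <= _).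
    by rewrite -col_mulmx !mxE.
  - move=> z; apply: RE; rewrite -(ler_nat R) card_mxsupp_cols.
    by rewrite (bigD1 k)//= lerDl; apply: sumr_ge0.
split.
  rewrite mxnorm11_cols card_mxsupp_cols mulr_sumr.
  by apply: ler_sum => k _; have [] := bnd k.
have c0 : 0 <= 3 * lam / kappa by rewrite divr_ge0 ?mulr_ge0// ltW.
rewrite mxnorm22E -(ger0_norm c0) -sqrtr_sqr -sqrtrM ?sqr_ge0// ler_sqrt; last first.
  by rewrite mulr_ge0// sqr_ge0.
rewrite exchange_big card_mxsupp_cols mulr_sumr; apply: ler_sum => k _.
have [_] := bnd k; congr (_ <= _).
by apply: eq_bigr => j _; rewrite [col _ _ _ _]mxE.
Qed.

Lemma lda_loss_step S U W V (h : R) : S^T = S ->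
  lda_loss S U (h *: V + W) =
  lda_loss S U W + h * mxdot V (S *m W - U) + h ^+ 2 * (2^-1 * mxdot V (S *m V)).
Proof.
move=> S_sym; rewrite /lda_loss mulmxDr -scalemxAr.
rewrite !(mxdotDl, mxdotDr, mxdotNr, mxdotZl, mxdotZr).
have -> : mxdot W (S *m V) = mxdot V (S *m W).
  rewrite mxdotC /mxdot trmx_mul S_sym mulmxA; congr (\tr (_ *m _)).
by field.
Qed.

(** Off zero the difference quotient of a quadratic function is affine in the step [h], so its limit
    is read off at [h = 0]. *)
Lemma gradient_lda_loss S U W : S^T = S -> gradient (lda_loss S U) W = S *m W - U.
Proof.
move=> S_sym; apply/matrixP => j k; rewrite mxE.
set V := delta_mx j k.
have VE : mxdot V (S *m W - U) = (S *m W - U) j k.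
  rewrite /mxdot /V trmx_delta /mxtrace (bigD1 k)//= big1 ?addr0.
    by rewrite mxE (bigD1 j)//= big1 ?addr0 ?mxE ?eqxx ?mul1r// => i ij; rewrite !mxE (negPf ij) andbF mul0r.
  by move=> l lk; rewrite mxE big1// => i _; rewrite !mxE (negPf lk) mul0r.
rewrite /derive; apply/cvg_lim => //.
pose g h := (S *m W - U) j k + h * (2^-1 * mxdot V (S *m V)).
have gc : g h @[h --> (0 : R)^'] --> (S *m W - U) j k.
  suff gc0 : g h @[h --> (0 : R)] --> (S *m W - U) j k.
    exact: (cvg_trans (cvg_app g (@nbhs_dnbhs _ (0 : R))) gc0).
  rewrite -[X in _ --> X]addr0 -[X in _ --> _ + X](mul0r (2^-1 * mxdot V (S *m V))).
  apply: cvgD; first exact: cvg_cst.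
  by apply: cvgMl; exact: cvg_id.
apply: cvg_trans gc; apply: near_eq_cvg; near=> h.
have h0 : h != 0 by near: h; exact: nbhs_dnbhs_neq.
rewrite /= lda_loss_step// VE /g; apply/esym.
by rewrite /GRing.scale/=; field.
Unshelve. all: by end_near.
Qed.

Lemma lda_argmin S U W : S^T = S -> (forall V, 0 <= mxdot V (S *m V)) ->
  is_argmin (lda_loss S U) W -> S *m W = U.
Proof.
move=> S_sym S_psd min; apply/eqP; rewrite -subr_eq0; apply/eqP.
set V := S *m W - U; set a := mxdot V V; set c := mxdot V (S *m V).
have a0 : 0 <= a.
  rewrite /a mxdot_cols; apply: sumr_ge0 => k _; rewrite mxdot_sqr.
  by apply: sumr_ge0 => j _; exact: sqr_ge0.
have c0 : 0 <= c := S_psd V.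
suff : a <= 0.
  move=> aL; have {aL} : a == 0 by rewrite eq_le aL.
  rewrite /a mxdot_cols psumr_eq0; last first.
    by move=> k _; rewrite mxdot_sqr; apply: sumr_ge0 => j _; exact: sqr_ge0.
  move=> /allP h; apply/matrixP => j k; rewrite [RHS]mxE.
  have := h k (mem_index_enum _); rewrite /= mxdot_sqr psumr_eq0; last first.
    by move=> i _; exact: sqr_ge0.
  by move=> /allP/(_ j (mem_index_enum _)); rewrite /= sqrf_eq0 [col _ _ _ _]mxE => /eqP.
rewrite leNgt; apply/negP => apos.
(* The exact line search would use [a / c]; the denominator [c + a] also covers zero curvature and
   still decreases the loss by at least half of [a ^ 2 / (c + a)]. *)
have := min (- (a / (c + a)) *: V + W); rewrite lda_loss_step// -/V -/a -/c.
have ca : 0 < c + a by lra.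
set t := a / (c + a); have t0 : 0 < t by rewrite divr_gt0.
have tE : t * (c + a) = a by rewrite /t divfK// lt0r_neq0.
have : t * c <= a by nra.
nra.
Qed.

End Matrix_lasso.

(** * The error recursion of the iterates *)

Section Recursion.
Context {R : realType}.

(** The right-hand side solves the recursion with equality, so [q > 1] is covered as well. *)
Lemma affine_recursion (a q : R) (e : nat -> R) : q != 1 -> 0 <= q ->
  (forall t, e t.+1 <= a + q * e t) ->
  forall t, e t <= a * (1 - q ^+ t) / (1 - q) + q ^+ t * e 0%N.
Proof.
move=> q1 q0 step; have q1' : 1 - q != 0 by rewrite subr_eq0 eq_sym.
elim=> [|t IH]; first by rewrite expr0 subrr mulr0 mul0r add0r mul1r.
apply: le_trans (step t) _.
have -> : a * (1 - q ^+ t.+1) / (1 - q) + q ^+ t.+1 * e 0%N =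
    a + q * (a * (1 - q ^+ t) / (1 - q) + q ^+ t * e 0%N).
  by rewrite exprS; field.
by rewrite lerD2l ler_wpM2l.
Qed.

End Recursion.

Lemma mx_subE (V : zmodType) m n (A B : 'M[V]_(m, n)) i j :
  (A - B) i j = A i j - B i j.
Proof. by rewrite !mxE. Qed.

Section Iterates.
Context (R : realType) (d p : nat).
Implicit Types (W G : 'M[R]_(d, p)).

Lemma mxnorm11_ge0 W : 0 <= mxnorm 1 1 W.
Proof. by rewrite mxnorm11E; apply: sumr_ge0 => i _; exact: sumr_ge0. Qed.

Lemma abs_mulmx_le (S : 'M[R]_d) W (e : R) j k : 0 <= e ->
  (forall l, `|S j l| <= e) -> `|(S *m W) j k| <= e * mxnorm 1 1 W.
Proof.
move=> e0 Se; rewrite mxE; apply: le_trans (ler_norm_sum _ _ _) _.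
rewrite mxnorm11E mulr_sumr; apply: ler_sum => l _; rewrite normrM.
apply: ler_pM => //; rewrite (bigD1 k)//= lerDl; exact: sumr_ge0.
Qed.

Variables (S1 SN : 'M[R]_d) (U1 UN Wstar : 'M[R]_(d, p)).
Variables (a b kappa0 : R).
Let s := #|mxsupp Wstar|.
Hypotheses (S1_sym : S1^T = S1) (S1_psd : forall v, 0 <= bform S1 v v).
Hypotheses (a_gt0 : 0 < a) (b_ge0 : 0 <= b) (kappa0_gt0 : 0 < kappa0).
Hypothesis s_gt0 : (0 < s)%N.
Hypothesis SN_residual : forall j k, `|(SN *m Wstar - UN) j k| <= a.
Hypothesis SN_S1 : forall j l, `|(SN - S1) j l| <= b.
Hypothesis S1_RE : forall (A : {set 'I_d}) (z : 'cV[R]_d), (#|A| <= s)%N ->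
  in_cone A z -> kappa0 / 8 * \sum_j z j 0 ^+ 2 <= bform S1 z z.

Variables (lambda : nat -> R) (What : nat -> 'M[R]_(d, p)).
Let e t := mxnorm 1 1 (What t - Wstar).
Hypothesis lambdaS : forall t, lambda t.+1 = 2 * a + 2 * b * e t.
Hypothesis What_argmin : forall t, is_argmin
  (fun W => lda_loss S1 U1 W
            + mxdot ((SN *m What t - UN) - (S1 *m What t - U1)) W
            + lambda t.+1 * mxnorm 1 1 W) (What t.+1).

Let fa := 192 * a * s%:R / kappa0.
Let fb := 192 * b * s%:R / kappa0.
Hypothesis fb_neq1 : fb != 1.

(** The gradient of the surrogate at [Wstar] is [(SN Wstar - UN) + (SN - S1) (What t - Wstar)]: the
    gap between local and global covariance is multiplied by the previous error, so the entries are
    at most [a + b * e t], half of the penalty. With curvature [kappa0 / 8] the factor is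
    [12 * 8 * 2 = 192] in l1 norm, and [3 * 8 * 2 = 192 / 4] in Frobenius norm. *)
Lemma iterates_step t :
  e t.+1 <= fa + fb * e t /\
  mxnorm 2 2 (What t.+1 - Wstar) <= (fa + fb * e t) / (4 * Num.sqrt s%:R).
Proof.
have e0 := mxnorm11_ge0 (What t - Wstar).
have s0 : 0 < s%:R :> R by rewrite ltr0n.
have lam0 : 0 < lambda t.+1.
  by rewrite lambdaS ltr_pwDl ?mulr_gt0// !mulr_ge0.
have k8 : 0 < kappa0 / 8 by rewrite divr_gt0.
have res j k : `|(S1 *m Wstar - (U1 - ((SN *m What t - UN) - (S1 *m What t - U1)))) j k|
    <= lambda t.+1 / 2.
  have -> : S1 *m Wstar - (U1 - ((SN *m What t - UN) - (S1 *m What t - U1))) =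
      (SN *m Wstar - UN) + (SN - S1) *m (What t - Wstar).
    rewrite mulmxBr !mulmxBl; apply/matrixP => i l; rewrite !mxE; ring.
  rewrite [X in `|X|]mxE (le_trans (ler_normD _ _))// lambdaS.
  have := SN_residual j k.
  have := @abs_mulmx_le _ (What t - Wstar) b j k b_ge0 (SN_S1 j); rewrite -/(e t); lra.
have [h1 h2] := lasso_matrix_bound S1_sym S1_psd lam0 k8 (What_argmin t) res S1_RE.
split.
  apply: le_trans h1 _; rewrite lambdaS /fa /fb -/s le_eqVlt; apply/orP; left; apply/eqP.
  by field; rewrite lt0r_neq0.
apply: le_trans h2 _; rewrite lambdaS /fa /fb -/s le_eqVlt; apply/orP; left; apply/eqP.
have sq0 : Num.sqrt s%:R != 0 :> R by rewrite lt0r_neq0// sqrtr_gt0.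
have ss : s%:R = Num.sqrt s%:R ^+ 2 :> R by rewrite sqr_sqrtr.
set r := Num.sqrt s%:R in sq0 ss *; rewrite ss; field.
by rewrite sq0 lt0r_neq0.
Qed.

Lemma iterates_bound t :
  e t.+1 <= fa * (1 - fb ^+ t.+1) / (1 - fb) + fb ^+ t.+1 * e 0%N /\
  mxnorm 2 2 (What t.+1 - Wstar)
    <= fa * (1 - fb ^+ t.+1) / (4 * Num.sqrt s%:R * (1 - fb))
       + fb ^+ t.+1 / (4 * Num.sqrt s%:R) * e 0%N.
Proof.
have fb0 : 0 <= fb by rewrite /fb divr_ge0 ?mulr_ge0 ?ler0n// ltW.
have fb1 : 1 - fb != 0 by rewrite subr_eq0 eq_sym.
have rec := affine_recursion fb_neq1 fb0 (fun t => (iterates_step t).1).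
split; first exact: rec.
apply: le_trans (iterates_step t).2 _.
have sq0 : 0 < Num.sqrt s%:R :> R by rewrite sqrtr_gt0 ltr0n.
have -> : fa * (1 - fb ^+ t.+1) / (4 * Num.sqrt s%:R * (1 - fb))
       + fb ^+ t.+1 / (4 * Num.sqrt s%:R) * e 0%N =
   (fa + fb * (fa * (1 - fb ^+ t) / (1 - fb) + fb ^+ t * e 0%N)) / (4 * Num.sqrt s%:R).
  by rewrite exprS; field; rewrite fb1 lt0r_neq0.
rewrite ler_pM2r ?invr_gt0 ?mulr_gt0// lerD2l ler_wpM2l//; exact: rec.
Qed.

End Iterates.

Section Sample_matrices.
Context (R : realType) (d K b : nat) (K_gt0 : (0 < K)%N) (b_gt0 : (0 < b)%N).
Variables (y : 'I_(K * b) -> 'I_K) (x : 'I_(K * b) -> 'cV[R]_d).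

Lemma pooled_cov_sym : (pooled_cov y x)^T = pooled_cov y x.
Proof.
rewrite /pooled_cov linearZ/= linear_sum/=; congr (_ *: _).
apply: eq_bigr => k _; rewrite linear_sum/=; apply: eq_bigr => i _.
by rewrite trmx_mul trmxK.
Qed.

Lemma pooled_cov_psd (v : 'cV[R]_d) : 0 <= bform (pooled_cov y x) v v.
Proof.
rewrite /pooled_cov bformZ mulr_ge0//.
  by rewrite invr_ge0 subr_ge0 ler_nat leq_pmulr.
rewrite bform_sum; apply: sumr_ge0 => k _; rewrite bform_sum.
by apply: sumr_ge0 => i _; rewrite bform_outer sqr_ge0.
Qed.

Hypothesis y_bal : balanced_labels y.

Lemma local_U_subE (mu : 'I_K -> 'cV[R]_d) j k :
  (local_U y x - population_U mu) j k =
  (class_mean y x (widen_ord (leq_pred K) k) - mu (widen_ord (leq_pred K) k)) j 0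
  - \sum_l K%:R^-1 * (class_mean y x l - mu l) j 0.
Proof.
have centE (m : 'I_K -> 'cV[R]_d) mb : centered_means m mb j k =
    m (widen_ord (leq_pred K) k) j 0 - mb j 0 by rewrite !mxE.
have sumE (F : 'I_K -> 'cV[R]_d) : (\sum_l K%:R^-1 *: F l) j 0 = \sum_l K%:R^-1 * F l j 0.
  by rewrite summxE; apply: eq_bigr => l _; rewrite mxE.
rewrite mx_subE !centE (grand_meanE y x) !sumE mx_subE.
under [X in _ = _ - X]eq_bigr do rewrite mx_subE mulrBr.
by rewrite sumrB; ring.
Qed.

End Sample_matrices.

Lemma polarization (R : realType) (d : nat) (S : 'M[R]_d) j l : S^T = S ->
  4 * S j l = bform S (delta_mx j 0 + delta_mx l 0) (delta_mx j 0 + delta_mx l 0)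
            - bform S (delta_mx j 0 - delta_mx l 0) (delta_mx j 0 - delta_mx l 0).
Proof.
move=> S_sym; rewrite -(scaleN1r (delta_mx l 0)) !(bformDl, bformDr, bformZl, bformZr) !bform_delta.
have -> : S l j = S j l by rewrite -[in LHS]S_sym mxE.
ring.
Qed.

(** * The good event *)

Lemma union_bound (dT : measure_display) (T : measurableType dT) (R : realType)
    (P : probability T R) (I : finType) (F : I -> set T) (p : R) :
  (forall i, measurable (F i) /\ (P (F i) <= p%:E)%E) ->
  exists U : set T, [/\ measurable U, (P U <= (#|I|%:R * p)%:E)%E &
    forall i, F i `<=` U].
Proof.
move=> FP; rewrite cardE.
suff [U [mU PU FU]] : exists U : set T, [/\ measurable U,
    (P U <= ((size (enum I))%:R * p)%:E)%E & forall i, i \in enum I -> F i `<=` U].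
  by exists U; split => // i; apply: FU; rewrite mem_enum.
elim: (enum I) => [|i s [U [mU PU FU]]] /=.
  by exists set0; split => //; rewrite measure0 mul0r.
exists (F i `|` U); split.
- by apply: measurableU => //; exact: (FP i).1.
- apply: le_trans (measureU2 _ (FP i).1 mU) _.
  rewrite -natr1 mulrDl mul1r addrC EFinD; apply: leeD => //; exact: (FP i).2.
- move=> h; rewrite inE => /orP[/eqP ->|hs]; first exact: subsetUl.
  by apply: subset_trans (FU h hs) _; exact: subsetUr.
Qed.

Section Logarithms.
Context {R : realType}.

Lemma expR_ln_div (x delta : R) : 0 < delta -> 1 <= x ->
  expR (ln (x / delta)) = x / delta.
Proof. by move=> d0 x1; rewrite lnK// posrE divr_gt0// (lt_le_trans ltr01). Qed.

Lemma expRN_ln_div_le (x delta : R) : 0 < delta -> 1 <= x ->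
  expR (- ln (x / delta)) <= delta.
Proof.
move=> d0 x1; have x0 : 0 < x by exact: lt_le_trans x1.
rewrite expRN expR_ln_div// invf_div ler_pdivrMr//; nra.
Qed.

Lemma tail_le_half (x delta e : R) : 0 < delta -> delta <= 2^-1 -> 1 <= x ->
  e <= - (2 * ln (x / delta)) -> expR e <= delta / 2.
Proof.
move=> d0 d2 x1 eL.
have h := expRN_ln_div_le d0 x1.
apply: (@le_trans _ _ (expR (- ln (x / delta) + - ln (x / delta)))).
  by rewrite ler_expR; lra.
rewrite expRD; have : 0 <= expR (- ln (x / delta)) by exact: expR_ge0.
nra.
Qed.

Lemma ln_div_ge_half (x delta : R) : 0 < delta -> delta <= 3^-1 -> 1 <= x ->
  2^-1 <= ln (x / delta).
Proof.
move=> d0 d3 x1; rewrite -ler_expR expR_ln_div//.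
have h : expR (2^-1 : R) ^+ 2 <= 4.
  by rewrite -expRM_natl mulfV ?pnatr_eq0// expR1_le4.
have h2 : expR (2^-1) <= 3 :> R.
  by have := expR_ge0 (2^-1 : R); nra.
apply: le_trans h2 _; rewrite ler_pdivlMr//; nra.
Qed.

(** Since [ln m <= m - 1] and [2 * ln (x / delta) >= 1]. The local sample size condition, multiplied
    by [M], thus also dominates [ln (d M / delta)]. *)
Lemma ln_div_mul_le (x delta : R) (m : nat) : (0 < m)%N -> 0 < delta ->
  delta <= 3^-1 -> 1 <= x ->
  ln (x / delta) <= ln (x * m%:R / delta) <= 2 * m%:R * ln (x / delta).
Proof.
move=> m0 d0 d3 x1; have L := ln_div_ge_half d0 d3 x1.
have m1 : 1 <= m%:R :> R by rewrite ler1n.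
have x0 : 0 < x by exact: lt_le_trans x1.
have -> : ln (x * m%:R / delta) = ln (x / delta) + ln m%:R.
  by rewrite -lnM ?posrE ?divr_gt0 ?ltr0n// mulrAC.
have lm0 : 0 <= ln m%:R :> R by exact: ln_ge0.
have lm : ln m%:R <= m%:R - 1 :> R.
  by have := @le_ln1Dx R (m%:R - 1); rewrite [1 + _]addrC subrK; apply; lra.
apply/andP; split; nra.
Qed.

End Logarithms.

(** Splits one sample size condition into its three uses: entrywise deviations of the first machine,
    those of the average over all machines ([lM] is the logarithm containing [M]), and the union
    bound over walks of length [k s + 1], for which [k s + 5 <= (k + 5) s]. *)
Lemma sample_size_bounds (R : realType) (beta B l lM : R) (k s M n : nat) :
  0 < beta -> 0 <= B -> 0 <= l -> lM <= 2 * M%:R * l -> (0 < M)%N -> (0 < s)%N ->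
  ((k%:R + 5) / beta + 2 * B) * s%:R * l <= n%:R ->
  [/\ B * l <= n%:R, B * lM <= (M * n)%:R &
      ((k * s).+1%:R + 4) * l <= beta * n%:R].
Proof.
move=> beta0 B0 l0 lMl M0 s0 n_ge.
have s1 : 1 <= s%:R :> R by rewrite ler1n.
have sl : l <= s%:R * l by rewrite ler_peMl.
have sl0 : 0 <= s%:R * l by exact: le_trans sl.
have k0 : 0 <= (k%:R + 5) / beta * (s%:R * l).
  by rewrite mulr_ge0// divr_ge0 ?addr_ge0// ltW.
have Bl : B * l <= B * (s%:R * l) by exact: ler_wpM2l.
have Bl0 : 0 <= B * l by exact: mulr_ge0.
have {}n_ge : (k%:R + 5) / beta * (s%:R * l) + 2 * (B * (s%:R * l)) <= n%:R.
  by apply: le_trans n_ge; lra.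
split; first lra.
  rewrite natrM; apply: (@le_trans _ _ (M%:R * (2 * (B * l)))).
    by have := ler_wpM2l B0 lMl; lra.
  by rewrite ler_wpM2l//; lra.
apply: (@le_trans _ _ ((k%:R + 5) * (s%:R * l))).
  by rewrite -natr1 natrM; lra.
have -> : (k%:R + 5) * (s%:R * l) = beta * ((k%:R + 5) / beta * (s%:R * l)).
  by field; rewrite lt0r_neq0.
by rewrite ler_wpM2l ?(ltW beta0)//; lra.
Qed.

(** Polarization expresses an entry through the walks [e_j + e_l] and [e_j - e_l], whose forms sum
    to [2 S_jj + 2 S_ll] by the parallelogram identity. A relative deviation thus becomes an
    entrywise one that involves only the diagonal of [S]. *)
Lemma entry_deviation (R : realType) (d : nat) (S Shat : 'M[R]_d) (tau c : R) j l :
  S^T = S -> Shat^T = Shat -> 0 <= tau -> (forall i, S i i <= c) ->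
  (forall t : 2.-tuple ('I_d * bool),
     `|bform Shat (walk R t) (walk R t) - bform S (walk R t) (walk R t)|
      <= tau * bform S (walk R t) (walk R t)) ->
  `|(Shat - S) j l| <= tau * c.
Proof.
move=> S_sym Shat_sym tau0 Sc dev.
have w1 : walk R [tuple (j, false); (l, false)] = delta_mx j 0 + delta_mx l 0.
  by rewrite /walk !big_cons big_nil /signed_unit /= expr0 !scale1r addr0.
have w2 : walk R [tuple (j, false); (l, true)] = delta_mx j 0 - delta_mx l 0.
  by rewrite /walk !big_cons big_nil /signed_unit /= expr0 expr1 scale1r scaleN1r addr0.
have := dev [tuple (j, false); (l, false)]; have := dev [tuple (j, false); (l, true)].
rewrite w1 w2 !ler_norml => /andP[h1 h2] /andP[h3 h4].
have pS := polarization j l S_sym; have pH := polarization j l Shat_sym.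
set ep := delta_mx j 0 + delta_mx l 0 in h1 h2 h3 h4 pS pH *.
set em := delta_mx j 0 - delta_mx l 0 in h1 h2 h3 h4 pS pH *.
have qq : bform S ep ep + bform S em em = 2 * S j j + 2 * S l l.
  rewrite /ep /em -(scaleN1r (delta_mx l 0)) !(bformDl, bformDr, bformZl, bformZr) !bform_delta.
  ring.
have h5 : tau * bform S ep ep + tau * bform S em em <= 4 * (tau * c).
  rewrite -mulrDr qq; have := Sc j; have := Sc l; nra.
have -> : (Shat - S) j l = Shat j l - S j l by rewrite !mxE.
by apply/andP; split; lra.
Qed.

Section Good_event.
Context (R : realType) (sigma2 c : R) (sigma2_gt0 : 0 < sigma2) (c_gt0 : 0 < c).
Context (K M d b : nat) (K_gt0 : (0 < K)%N) (M_gt0 : (0 < M)%N) (b_ge2 : (2 <= b)%N).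
Context (Q : 'I_K -> probability (d.-tuple R) R).
Variables (mu : 'I_K -> 'cV[R]_d) (Sigma : 'M[R]_d).
Hypothesis Sigma_unit : Sigma \in unitmx.
Hypothesis Q_moments : forall k, has_mean_cov (Q k) (mu k) Sigma.
Hypothesis Q_sub_gaussian : forall k, sub_gaussian sigma2 (Q k) (mu k) Sigma.
Hypothesis Sigma_diag : forall j, Sigma j j <= c.
Context (dOm : measure_display) (Om : measurableType dOm) (P : probability Om R).
Variable y : 'I_M -> 'I_(K * b) -> 'I_K.
Hypothesis y_bal : forall m, balanced_labels (y m).
Variable X : 'I_M * 'I_(K * b) -> {RV P >-> d.-tuple R}.
Hypothesis X_indep : mutually_independent X.
Hypothesis X_law : forall m i, has_law (X (m, i)) (Q (y m i)).
Variables (delta : R) (delta_gt0 : 0 < delta) (delta_le : delta <= 3^-1).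

Local Notation Shat := (pooled_avg y X).

Lemma walk_deviation_event (S : {set 'I_M}) (r : nat) (t : R) :
  (0 < #|S|)%N -> 0 < t <= 1 ->
  exists U : set Om, [/\ measurable U,
    (P U <= ((d * 2) ^ r)%:R%:E * (4 * expR (- ((t / 192) ^+ 2 * (#|S| * (K * b))%:R / 2)))%:E)%E &
    forall w, ~ U w -> forall z : r.-tuple ('I_d * bool),
      `|bform (Shat S w) (walk R z) (walk R z) - bform Sigma (walk R z) (walk R z)|
        <= 4 * t * sigma2 * bform Sigma (walk R z) (walk R z)].
Proof.
move=> S0 t01.
have [U [mU PU FU]] := union_bound (fun z : r.-tuple ('I_d * bool) =>
  quad_tail sigma2_gt0 b_ge2 Sigma_unit Q_moments Q_sub_gaussian y_bal X_indep X_law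
    (walk R z) K_gt0 S0 t01).
exists U; split => //.
  apply: le_trans PU _; rewrite -EFinM.
  by rewrite card_tuple card_prod card_ord card_bool.
move=> w Uw z; rewrite leNgt; apply/negP => h; apply: Uw; apply: (FU z) => /=.
by rewrite mulrA.
Qed.

Hypothesis d_gt0 : (0 < d)%N.
Local Notation L := (ln (d%:R / delta)).
Local Notation LM := (ln (d%:R * M%:R / delta)).
Local Notation LK := (ln (d%:R * M%:R * K%:R / delta)).
Local Notation n := (K * b)%N.
Local Notation N := (M * (K * b))%N.

(* Chosen so that the exponent of [walk_deviation_event] at [t = A sqrt (l / N)]
   is [8 * l]. *)
Let A : R := 192 * 4.

Let d1 : 1 <= d%:R :> R. Proof. by rewrite ler1n. Qed.
Let M1 : 1 <= M%:R :> R. Proof. by rewrite ler1n. Qed.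
Let K1 : 1 <= K%:R :> R. Proof. by rewrite ler1n. Qed.
Let dM1 : 1 <= d%:R * M%:R :> R. Proof. by rewrite -natrM ler1n muln_gt0 d_gt0. Qed.
Let dMK1 : 1 <= d%:R * M%:R * K%:R :> R.
Proof. by rewrite -!natrM ler1n !muln_gt0 d_gt0 M_gt0. Qed.
Let delta_le2 : delta <= 2^-1. Proof. by move: delta_le; lra. Qed.

Let two_le_expR (x : R) : 1 <= x -> 2 <= expR (ln (x / delta)).
Proof. by move=> x1; rewrite expR_ln_div// ler_pdivlMr//; move: delta_gt0 delta_le; nra. Qed.

Let count_le (x : R) : d%:R <= x -> (d * 2)%:R <= expR (ln (x / delta)).
Proof.
by move=> dx; rewrite expR_ln_div ?(le_trans d1)// natrM ler_pdivlMr//; move: d1 delta_gt0 delta_le dx; nra.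
Qed.

Let expR_pow (r : nat) (l : R) : expR l ^+ r = expR (r%:R * l).
Proof. by rewrite expRM_natl. Qed.

(* Used with [x = d * M] for all machines, but with [x = d] for the first one:
   the local sample size is not assumed to dominate [ln M]. *)
Lemma max_deviation_event (S : {set 'I_M}) (x : R) : (0 < #|S|)%N -> d%:R <= x ->
  A ^+ 2 * ln (x / delta) <= (#|S| * n)%:R ->
  exists U : set Om, [/\ measurable U, (P U <= (delta / 2)%:E)%E &
    forall w, ~ U w -> forall j l, `|(Shat S w - Sigma) j l|
      <= 4 * A * sigma2 * c * Num.sqrt (ln (x / delta) / (#|S| * n)%:R)].
Proof.
move=> S0 dx Ax; set l := ln (x / delta); set NS := (#|S| * n)%:R : R.
have x1 : 1 <= x by exact: le_trans dx.
have l0 : 0 < l by apply: lt_le_trans (ln_div_ge_half delta_gt0 delta_le x1); rewrite invr_gt0.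
have NS0 : 0 < NS.
  by rewrite ltr0n muln_gt0 S0 muln_gt0 K_gt0 (leq_trans _ b_ge2).
have lN0 : 0 < l / NS by rewrite divr_gt0.
set t := A * Num.sqrt (l / NS).
have A0 : 0 < A by rewrite mulr_gt0 ?ltr0n.
have t2 : t ^+ 2 = A ^+ 2 * (l / NS) by rewrite exprMn sqr_sqrtr// ltW.
have t0 : 0 < t by rewrite mulr_gt0// sqrtr_gt0.
have t1 : t <= 1.
  by rewrite -(@expr_le1 _ 2)// ?(ltW t0)// t2 mulrA ler_pdivrMr// mul1r.
have [|U [mU PU FU]] := @walk_deviation_event S 2 t S0; first by rewrite t0.
exists U; split => //.
  apply: le_trans PU _; rewrite -EFinM lee_fin -/NS.
  have -> : (t / 192) ^+ 2 * NS / 2 = 8 * l.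
    rewrite exprMn t2 /A; field.
    by rewrite !pnatr_eq0 -!lt0n S0 K_gt0 (leq_trans _ b_ge2).
  (* The number of walks and the factor 4 are each at most [exp (2 l)]; half of the exponent [8 l]
     pays for them. *)
  apply: (@le_trans _ _ (expR l ^+ 2 * (expR l ^+ 2 * expR (- (8 * l))))).
    apply: ler_pM => //.
      by rewrite natrX; apply: lerXn2r; rewrite ?nnegrE ?expR_ge0//; exact: count_le.
    rewrite ler_wpM2r ?expR_ge0//.
    have : 2 <= expR l by exact: two_le_expR.
    rewrite expr2; nra.
  rewrite !expR_pow -!expRD.
  by apply: (@tail_le_half _ x) => //; rewrite -/l; lra.
move=> w Uw j k.
have h := @entry_deviation R d Sigma (Shat S w) (4 * t * sigma2) c j k.
have -> : 4 * A * sigma2 * c * Num.sqrt (l / NS) = 4 * t * sigma2 * c by rewrite /t; ring.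
apply: h => //.
- exact: has_mean_cov_sym (Q_moments (Ordinal K_gt0)).
- rewrite /pooled_avg linearZ/= linear_sum/=; congr (_ *: _).
  by apply: eq_bigr => m _; exact: pooled_cov_sym.
- by rewrite !mulr_ge0// ltW.
- exact: FU.
Qed.

Lemma mean_deviation_event : exists U : set Om, [/\ measurable U,
    (P U <= (delta / 2)%:E)%E &
    forall w, ~ U w -> forall k j, `|mean_dev mu y X k j w|
      <= 2^-1 * Num.sqrt (40 * sigma2 * c) * Num.sqrt (K%:R * LK / N%:R)].
Proof.
(* The factor [1 / 2] anticipates that a column of [local_U] subtracts the grand mean from a class
   mean, which doubles the deviation. A class has [M b = N / K] samples, whence the factor [K]. The
   constant 40 makes the exponent [5 * LK]: two parts pay for the union bound and the factor 2, and
   two suffice for [delta / 2]. *)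
set r := 2^-1 * Num.sqrt _ * _.
have LK0 : 0 < LK by apply: lt_le_trans (ln_div_ge_half delta_gt0 delta_le dMK1); rewrite invr_gt0.
have b0 : 0 < b%:R :> R by rewrite ltr0n (leq_trans _ b_ge2).
have K0 : 0 < K%:R :> R by rewrite ltr0n.
have M0 : 0 < M%:R :> R by rewrite ltr0n.
have NE : N%:R = M%:R * K%:R * b%:R :> R by rewrite !natrM mulrA.
have N0 : 0 < N%:R :> R by rewrite NE !mulr_gt0.
have r0 : 0 <= r by rewrite /r !mulr_ge0 ?sqrtr_ge0.
have r2 : r ^+ 2 = 10 * sigma2 * c * (K%:R * LK / N%:R).
  rewrite /r !exprMn !sqr_sqrtr; first by field; rewrite !lt0r_neq0.
    by rewrite divr_ge0// ?mulr_ge0// ltW.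
  by rewrite !mulr_ge0// ltW.
pose F (kj : 'I_K * 'I_d) := [set w | r < `|mean_dev mu y X kj.1 kj.2 w|].
have FP kj : measurable (F kj) /\ (P (F kj) <= (2 * expR (- (5 * LK)))%:E)%E.
  have [mF PF] := mean_tail sigma2_gt0 b_ge2 Sigma_unit Q_sub_gaussian y_bal X_indep X_law
    kj.1 kj.2 M_gt0 r0.
  split => //; apply: le_trans PF _; rewrite lee_fin ler_pM2l// ler_expR lerN2.
  have q0 : 0 < Sigma kj.2 kj.2.
    rewrite -bform_delta; apply: (bform_gt0 Sigma_unit (Q_sub_gaussian kj.1)).
    apply/eqP => /matrixP/(_ kj.2 0); rewrite !mxE !eqxx /=.
    by move/eqP; rewrite oner_eq0.
  rewrite r2 ler_pdivlMr ?mulr_gt0//.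
  have -> : 10 * sigma2 * c * (K%:R * LK / N%:R) * (M * b)%:R = 5 * LK * (2 * (sigma2 * c)).
    by rewrite natrM; field; rewrite !lt0r_neq0.
  have L5 : 0 <= 5 * LK by rewrite mulr_ge0// ltW.
  by rewrite ler_wpM2l// ler_wpM2l// ler_wpM2l// ltW.
have [U [mU PU FU]] := union_bound FP.
exists U; split => //.
  apply: le_trans PU _; rewrite lee_fin card_prod !card_ord.
  apply: (@le_trans _ _ (expR LK * (expR LK * expR (- (5 * LK))))).
    apply: ler_pM => //.
    - rewrite expR_ln_div// ler_pdivlMr// natrM.
      have : delta <= 1 by move: delta_le; lra.
      move: delta_gt0 M1 d1 K1.
      have : 0 <= K%:R * d%:R :> R by rewrite mulr_ge0.
      nra.
    - by rewrite ler_wpM2r ?expR_ge0//; exact: two_le_expR.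
  rewrite -!expRD.
  by apply: (@tail_le_half _ (d%:R * M%:R * K%:R)) => //; lra.
move=> w Uw k j; rewrite leNgt; apply/negP => h; apply: Uw.
by apply: (FU (k, j)).
Qed.

Lemma walk_relative_event (m1 : 'I_M) (k : nat) :
  (k%:R + 4) * L <= ((1 + 8 * sigma2)^-1 / 192) ^+ 2 * n%:R / 2 ->
  exists U : set Om, [/\ measurable U, (P U <= (delta / 2)%:E)%E &
    forall w, ~ U w -> forall z : k.-tuple ('I_d * bool),
      `|bform (Shat [set m1] w) (walk R z) (walk R z) - bform Sigma (walk R z) (walk R z)|
        <= 2^-1 * bform Sigma (walk R z) (walk R z)].
Proof.
(* This [t] is at most 1 and satisfies [4 * t * sigma2 <= 1 / 2]. Of [k + 4], the [k] counts the
   walks, 2 absorbs the factor 4, and 2 remain for [delta / 2]. *)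
move=> kn; set t := (1 + 8 * sigma2)^-1 in kn.
have s8 : 0 < 1 + 8 * sigma2 by move: sigma2_gt0; lra.
have t0 : 0 < t by rewrite invr_gt0.
have t1 : t <= 1 by rewrite invf_le1//; move: sigma2_gt0; lra.
have S0 : (0 < #|[set m1]%SET|)%N by rewrite cards1.
have [|U [mU PU FU]] := @walk_deviation_event [set m1]%SET k t S0; first by rewrite t0.
exists U; split => //.
  apply: le_trans PU _; rewrite -EFinM lee_fin cards1 mul1n.
  apply: (@le_trans _ _ (expR L ^+ k * (expR L ^+ 2 * expR (- ((t / 192) ^+ 2 * n%:R / 2))))).
    apply: ler_pM => //.
      by rewrite natrX; apply: lerXn2r; rewrite ?nnegrE ?expR_ge0//; exact: count_le.
    rewrite ler_wpM2r ?expR_ge0//.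
    have : 2 <= expR L by exact: two_le_expR.
    rewrite expr2; nra.
  rewrite !expR_pow -!expRD.
  by apply: (@tail_le_half _ d%:R) => //; lra.
move=> w Uw z; apply: le_trans (FU w Uw z) _.
apply: ler_wpM2r; first exact: (bform_ge0 Sigma_unit (Q_sub_gaussian (Ordinal K_gt0))).
rewrite -(ler_pM2r s8) /t.
have -> : 4 * (1 + 8 * sigma2)^-1 * sigma2 * (1 + 8 * sigma2) = 4 * sigma2.
  by field; rewrite lt0r_neq0.
lra.
Qed.

End Good_event.

(** * The error bounds on the good event *)

Lemma avg_local_U_subE (R : realType) (d K M b : nat) (K_gt0 : (0 < K)%N) (M_gt0 : (0 < M)%N)
    (dOm : measure_display) (Om : measurableType dOm) (P : probability Om R)
    (y : 'I_M -> 'I_(K * b) -> 'I_K) (X : 'I_M * 'I_(K * b) -> {RV P >-> d.-tuple R})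
    (mu : 'I_K -> 'cV[R]_d) (w : Om) (r : R) j k :
  (forall k j, `|mean_dev mu y X k j w| <= r) ->
  `|(M%:R^-1 *: (\sum_m local_U (y m) (fun i => col_of_tuple (X (m, i) w)))
     - population_U mu) j k| <= 2 * r.
Proof.
move=> dev; set UN := _ *: _.
have M0 : M%:R != 0 :> R by rewrite pnatr_eq0 -lt0n.
have K0 : 0 < K%:R :> R by rewrite ltr0n.
have -> : (UN - population_U mu) j k =
    mean_dev mu y X (widen_ord (leq_pred K) k) j w
    - \sum_l K%:R^-1 * mean_dev mu y X l j w.
  have -> : UN - population_U mu = M%:R^-1 *: \sum_m
      (local_U (y m) (fun i => col_of_tuple (X (m, i) w)) - population_U mu).
    rewrite sumrB scalerBr sumr_const card_ord; congr (_ - _).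
    by rewrite -(scaler_nat M (population_U mu)) scalerA mulVf// scale1r.
  rewrite mxE summxE.
  under eq_bigr do rewrite local_U_subE.
  rewrite sumrB mulrBr; congr (_ - _).
  rewrite exchange_big mulr_sumr; apply: eq_bigr => l _.
  by rewrite /mean_dev -mulr_sumr mulrCA.
apply: le_trans (ler_normB _ _) _; rewrite mulr_natl mulr2n lerD//.
apply: le_trans (ler_norm_sum _ _ _) _.
apply: (@le_trans _ _ (\sum_(l < K) K%:R^-1 * r)).
  apply: ler_sum => l _; rewrite normrM gtr0_norm ?invr_gt0//.
  by rewrite ler_wpM2l// invr_ge0 ltW.
by rewrite sumr_const card_ord -[_ *+ K]mulr_natl mulrA mulfV ?mul1r// lt0r_neq0.
Qed.

Theorem theorem3 (R : realType) (sigma2 c0 kappa0 : R)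
    (sigma2_gt0 : 0 < sigma2) (kappa0_gt0 : 0 < kappa0) :
  exists c1 c2 c3 : R,
    [/\ 0 < c1, 0 < c2 & 0 < c3] /\
    forall (K M d b : nat) (K_ge2 : (2 <= K)%N) (b_ge2 : (2 <= b)%N)
      (M_gt0 : (0 < M)%N) (delta : R) (delta_gt0 : 0 < delta)
      (delta_lt1 : delta < 1)
      (Q : 'I_K -> probability (d.-tuple R) R)
      (mu : 'I_K -> 'cV[R]_d) (Sigma : 'M[R]_d)
      (Sigma_nonsingular : Sigma \in unitmx)
      (Q_moments : forall k, has_mean_cov (Q k) (mu k) Sigma)
      (Q_sub_gaussian : forall k, sub_gaussian sigma2 (Q k) (mu k) Sigma)
      (Sigma_diag : forall j, Sigma j j <= c0)
      (Wstar : 'M[R]_(d, K.-1))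
      (Wstar_argmin : is_argmin (lda_loss Sigma (population_U mu)) Wstar)
      (dOm : measure_display) (Om : measurableType dOm) (P : probability Om R)
      (y : 'I_M -> 'I_(K * b) -> 'I_K)
      (y_balanced : forall m, balanced_labels (y m))
      (X : 'I_M * 'I_(K * b) -> {RV P >-> d.-tuple R})
      (X_independent : mutually_independent X)
      (X_law : forall m i, has_law (X (m, i)) (Q (y m i)))
      (lambda0 : R) (lambda0_gt0 : 0 < lambda0),
    let n : nat := (K * b)%N in
    let N : nat := (M * n)%N in
    let s : nat := #|mxsupp Wstar| in
    let a_n : R :=
      c1 * Num.sqrt (ln (d%:R * M%:R / delta) / N%:R) * mxnorm 1 1 Wstar
      + c2 * Num.sqrt (K%:R * ln (d%:R * M%:R * K%:R / delta) / N%:R) in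
    let b_n : R := 2 * c1 * Num.sqrt (ln (d%:R * M%:R / delta) / n%:R) in
    let fa : R := 192 * a_n * s%:R / kappa0 in
    let fb : R := 192 * b_n * s%:R / kappa0 in
    (1 <= s)%N ->
    fb != 1 ->
    restricted_eigenvalue kappa0 s Sigma ->
    c3 * s%:R * ln (d%:R / delta) <= n%:R ->
    exists E : set Om,
      [/\ measurable E,
          ((1 - 3 * delta)%:E <= P E)%E &
          forall (w : Om), E w ->
          forall (lambda : nat -> R) (What : nat -> 'M[R]_(d, K.-1)),
            lambda 0%N = lambda0 ->
            (forall t : nat, lambda t.+1
               = 2 * a_n + 2 * b_n * mxnorm 1 1 (What t - Wstar)) ->
            dmSLDA_iterates (Ordinal M_gt0)
              (fun m => local_loss (y m)
                          (fun i => col_of_tuple (X (m, i) w)))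
              lambda What ->
            forall t : nat,
              mxnorm 1 1 (What t.+1 - Wstar)
                <= fa * (1 - fb ^+ t.+1) / (1 - fb)
                   + fb ^+ t.+1 * mxnorm 1 1 (What 0%N - Wstar)
              /\
              mxnorm 2 2 (What t.+1 - Wstar)
                <= fa * (1 - fb ^+ t.+1) / (4 * Num.sqrt s%:R * (1 - fb))
                   + fb ^+ t.+1 / (4 * Num.sqrt s%:R)
                     * mxnorm 1 1 (What 0%N - Wstar)].
Proof.
(* The constants are chosen before any distribution is given, when [c0] may still be nonpositive. *)
set c := Num.max c0 1.
have c_gt0 : 0 < c by rewrite lt_max ltr01 orbT.
pose A : R := 192 * 4.
have A_gt0 : 0 < A by rewrite mulr_gt0 ?ltr0n.
(* The exponent per sample in the union bound over walks; [k0] below is the walk length per unit of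
   sparsity. *)
set beta := ((1 + 8 * sigma2)^-1 / 192) ^+ 2 / 2.
have beta_gt0 : 0 < beta.
  by rewrite !(divr_gt0, exprn_gt0, invr_gt0) ?ltr0n//; lra.
pose k0 := (Num.truncn (48 * c / kappa0)).+1.
have k0_le : 48 * c <= kappa0 * k0%:R.
  by rewrite [leRHS]mulrC -ler_pdivrMr// ltW// Num.Theory.truncnS_gt.
exists (4 * A * sigma2 * c), (Num.sqrt (40 * sigma2 * c)),
  ((k0%:R + 5) / beta + 2 * A ^+ 2).
split.
  split; first by rewrite !mulr_gt0 ?ltr0n.
    by rewrite sqrtr_gt0 !mulr_gt0 ?ltr0n.
  by rewrite addr_gt0 ?mulr_gt0 ?invr_gt0 ?exprn_gt0 ?ltr_wpDl ?ler0n ?ltr0n.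
move=> K M d b K_ge2 b_ge2 M_gt0 delta delta_gt0 delta_lt1 Q mu Sigma Sigma_unit
  Q_moments Q_sub Sigma_diag Wstar Wstar_argmin dOm Om P y y_bal X X_indep X_law
  lambda0 lambda0_gt0 n N s a_n b_n fa fb s_ge1 fb_neq1 RE n_ge.
(* For [delta > 1 / 3] the claimed probability is negative and the empty event serves. Otherwise all
   logarithms are at least [1 / 2]. *)
have [delta_le|delta_gt] := leP delta 3^-1; last first.
  exists set0; split => //; rewrite measure0 lee_fin subr_le0.
  by rewrite -ler_pdivrMl ?ltr0n// mulr1 ltW.
have K_gt0 : (0 < K)%N by exact: leq_trans K_ge2.
have b_gt0 : (0 < b)%N by exact: leq_trans b_ge2.
have d_gt0 : (0 < d)%N.
  by move: s_ge1; rewrite card_gt0 => /set0Pn[[j _] _]; exact: leq_ltn_trans (ltn_ord j).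
have Sigma_le j : Sigma j j <= c by rewrite le_max Sigma_diag.
set m1 : 'I_M := Ordinal M_gt0.
pose L := ln (d%:R / delta); pose LM := ln (d%:R * M%:R / delta).
have d1 : 1 <= d%:R :> R by rewrite ler1n.
have dM1 : 1 <= d%:R * M%:R :> R by rewrite -natrM ler1n muln_gt0 d_gt0.
have L_ge : 2^-1 <= L by exact: ln_div_ge_half.
have /andP[L_LM LM_L] : L <= LM <= 2 * M%:R * L by exact: ln_div_mul_le.
have n_gt0 : (0 < n)%N by rewrite muln_gt0 K_gt0.
have n0 : 0 < n%:R :> R by rewrite ltr0n.
have L0 : 0 <= L by apply: le_trans L_ge; rewrite invr_ge0.
have NE : N%:R = M%:R * n%:R :> R by rewrite natrM.
have M1 : 1 <= M%:R :> R by rewrite ler1n.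
have [n_ge1 N_geM n_ge2] := sample_size_bounds beta_gt0 (sqr_ge0 A) L0 LM_L M_gt0 s_ge1 n_ge.
have {}n_ge2 : ((k0 * s).+1%:R + 4) * L <= ((1 + 8 * sigma2)^-1 / 192) ^+ 2 * n%:R / 2.
  by rewrite [leRHS]mulrAC.
have cT : #|[set: 'I_M]%SET| = M by rewrite cardsT card_ord.
have cT0 : (0 < #|[set: 'I_M]%SET|)%N by rewrite cT.
have c10 : (0 < #|[set m1]%SET|)%N by rewrite cards1.
have [||U1 [mU1 PU1 U1P]] := max_deviation_event sigma2_gt0 K_gt0 b_ge2 Sigma_unit
    Q_moments Q_sub Sigma_le y_bal X_indep X_law delta_gt0 delta_le d_gt0
    (x := d%:R * M%:R) cT0.
- by rewrite ler_peMr.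
- by rewrite cT.
have [||U2 [mU2 PU2 U2P]] := max_deviation_event sigma2_gt0 K_gt0 b_ge2 Sigma_unit
    Q_moments Q_sub Sigma_le y_bal X_indep X_law delta_gt0 delta_le d_gt0
    (x := d%:R) c10.
- by [].
- by rewrite cards1 mul1n.
have [U3 [mU3 PU3 U3P]] := mean_deviation_event sigma2_gt0 c_gt0 K_gt0 M_gt0 b_ge2 Sigma_unit
    Q_sub Sigma_le y_bal X_indep X_law delta_gt0 delta_le d_gt0.
have [U4 [mU4 PU4 U4P]] := walk_relative_event sigma2_gt0 K_gt0 b_ge2 Sigma_unit
    Q_moments Q_sub y_bal X_indep X_law delta_gt0 delta_le d_gt0 m1 n_ge2.
(* Four exceptional events, each of probability at most [delta / 2]. *)
pose U := (U1 `|` U2) `|` (U3 `|` U4).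
have mU : measurable U by do !apply: measurableU.
have PU : (P U <= (2 * delta)%:E)%E.
  have -> : 2 * delta = (delta / 2 + delta / 2) + (delta / 2 + delta / 2) by field.
  apply: le_trans (measureU2 _ _ _) _; [exact: measurableU|exact: measurableU|].
  rewrite EFinD; apply: leeD; apply: le_trans (measureU2 _ _ _) _ => //;
    by rewrite EFinD leeD.
exists (~` U); split; first exact: measurableC.
  rewrite probability_setC// -[P U]fineK ?fin_num_measure// -EFinB lee_fin.
  have h : fine (P U) <= 2 * delta by rewrite -lee_fin fineK// fin_num_measure.
  by clear -h delta_gt0; lra.
(* The event is fixed before the iterates: from here on everything is deterministic and holds for
   every selection of minimizers. *)
move=> w Uw lambda What _ lambdaS [_ What_argmin].
have {}U1P := U1P w (fun h => Uw (or_introl (or_introl h))).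
have {}U2P := U2P w (fun h => Uw (or_introl (or_intror h))).
have {}U3P := U3P w (fun h => Uw (or_intror (or_introl h))).
have {}U4P := U4P w (fun h => Uw (or_intror (or_intror h))).
pose x m i := col_of_tuple (X (m, i) w).
pose S m := pooled_cov (y m) (x m); pose V m := local_U (y m) (x m).
pose SN := M%:R^-1 *: \sum_m S m; pose VN := M%:R^-1 *: \sum_m V m.
have avgT : pooled_avg y X [set: 'I_M]%SET w = SN.
  rewrite /pooled_avg cT; congr (_ *: _).
  by apply: eq_bigl => m; rewrite inE.
have avg1 : pooled_avg y X [set m1]%SET w = S m1.
  by rewrite /pooled_avg cards1 invr1 scale1r big_set1.
rewrite avgT cT in U1P; rewrite avg1 cards1 mul1n in U2P; rewrite avg1 in U4P.
have S_sym m : (S m)^T = S m by exact: pooled_cov_sym.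
have S_psd m v : 0 <= bform (S m) v v by exact: pooled_cov_psd.
have Sigma_sym : Sigma^T = Sigma := has_mean_cov_sym (Q_moments (Ordinal K_gt0)).
have Sigma_psd (W : 'M[R]_(d, K.-1)) : 0 <= mxdot W (Sigma *m W).
  rewrite mxdot_cols; apply: sumr_ge0 => k _.
  have := bform_ge0 Sigma_unit (Q_sub (Ordinal K_gt0)) (col k W).
  by rewrite /bform col_mulmx -mulmxA /mxdot /mxtrace big_ord1.
have WstarE := lda_argmin Sigma_sym Sigma_psd Wstar_argmin.
have LM0 : 0 < LM.
  by apply: lt_le_trans L_LM; apply: lt_le_trans L_ge; rewrite invr_gt0.
have LMN : 0 <= LM / N%:R by rewrite divr_ge0// ltW.
pose c1 := 4 * A * sigma2 * c; have c1_gt0 : 0 < c1 by rewrite /c1 !mulr_gt0 ?ltr0n.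
have sqN : 0 <= Num.sqrt (LM / N%:R) by exact: sqrtr_ge0.
have Wn := mxnorm11_ge0 Wstar.
have LK0 : 0 < ln (d%:R * M%:R * K%:R / delta).
  apply: lt_le_trans (ln_div_ge_half delta_gt0 delta_le _); first by rewrite invr_gt0.
  by rewrite -!natrM ler1n !muln_gt0 d_gt0 M_gt0.
have N_gt0 : 0 < N%:R :> R by rewrite ltr0n muln_gt0 M_gt0.
have a_gt0 : 0 < a_n.
  rewrite /a_n ltr_wpDl//; first by rewrite !mulr_ge0 ?ler0n// ltW.
  by rewrite mulr_gt0// sqrtr_gt0 ?mulr_gt0// ?invr_gt0// ltr0n.
have b_ge0 : 0 <= b_n.
  by rewrite /b_n mulr_ge0 ?sqrtr_ge0// mulr_ge0// ltW.
(* As [Sigma *m Wstar] is the population [U], the residual contains only the deviations of the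
   covariance and of the means, which match the two terms of [a_n]. *)
have res j k : `|(SN *m Wstar - VN) j k| <= a_n.
  have -> : SN *m Wstar - VN = (SN - Sigma) *m Wstar - (VN - population_U mu).
    by rewrite mulmxBl WstarE opprB addrA subrK.
  rewrite mx_subE; apply: le_trans (ler_normB _ _) _.
  rewrite /a_n lerD//.
    apply: abs_mulmx_le; first by rewrite mulr_ge0// ltW.
    by move=> l; exact: U1P.
  have := @avg_local_U_subE R d K M b K_gt0 M_gt0 dOm Om P y X mu w _ j k U3P.
  by rewrite -mulrA mulVKf.
(* Both covariances are compared with [Sigma]. The bound for the average is the smaller one because
   [N >= n], so twice the local rate suffices; this is the 2 in [b_n]. *)
have dev j l : `|(SN - S m1) j l| <= b_n.
  have -> : SN - S m1 = (SN - Sigma) - (S m1 - Sigma) by rewrite opprB addrA subrK.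
  rewrite mx_subE; apply: le_trans (ler_normB _ _) _.
  have -> : b_n = c1 * Num.sqrt (LM / n%:R) + c1 * Num.sqrt (LM / n%:R).
    by rewrite /b_n -/LM /c1; ring.
  apply: lerD.
    apply: le_trans (U1P j l) _; rewrite ler_wpM2l ?(ltW c1_gt0)//.
    apply: ler_wsqrtr; rewrite ler_wpM2l ?(ltW LM0)// lef_pV2 ?posrE//.
    by rewrite NE ler_peMl// ltW.
  apply: le_trans (U2P j l) _; rewrite ler_wpM2l ?(ltW c1_gt0)//.
  by apply: ler_wsqrtr; rewrite ler_wpM2r// invr_ge0 ltW.
have RE1 := restricted_eigenvalue_sample kappa0_gt0 k0_le s_ge1 c_gt0 Sigma_le RE U4P.
have argmin t : is_argmin (fun W => lda_loss (S m1) (V m1) W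
    + mxdot ((SN *m What t - VN) - (S m1 *m What t - V m1)) W
    + lambda t.+1 * mxnorm 1 1 W) (What t.+1).
  have gradE m : gradient (local_loss (y m) (x m)) (What t) = S m *m What t - V m.
    exact: gradient_lda_loss (S_sym m).
  have := What_argmin t; rewrite (gradE m1) (eq_bigr _ (fun m _ => gradE m)).
  by rewrite sumrB scalerBr -mulmx_suml scalemxAl.
move=> t; exact: (iterates_bound (S_sym m1) (S_psd m1) a_gt0 b_ge0 kappa0_gt0 s_ge1
  res dev RE1 lambdaS argmin fb_neq1).
Qed.
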